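(* Let $\mathcal{G}$ be a family of finite nilpotent groups of bounded exponent (there is a constant $m$ such that every $G\in\mathcal{G}$ has exponent at most $m$). Suppose that at least one of the following holds: (1) $\mathcal{G}$ has bounded variance: there is a constant $M$ such that for every $G\in\mathcal{G}$, every prime $p$ dividing $|G|$, and $P$ the Sylow $p$-subgroup of $G$, the $p$-degrees $r$ of $P$ satisfy $\mathrm{Var}(X_r)\le M$; (2) $\mathcal{G}$ has linear expectation: there is a constant $c>0$ such that for every $G\in\mathcal{G}$, every prime $p$ dividing $|G|$, and $P$ the Sylow $p$-subgroup of $G$, the $p$-degrees $r=(r_1,\dots,r_\ell)$ of $P$ satisfy $\mathbb{E}(X_r)\ge \ell/c$, where $\ell$ is the length of the $p$-lower central series of $P$. Then STPP constructions in the family $\mathcal{G}$ cannot achieve $\omega=2$; that is, there is a real number $\tau$ with $2<\tau\le 3$ such that for every $G\in\mathcal{G}$ and every STPP construction $(S_i,T_i,U_i)_i$ in $G$, $$\sum_i (|S_i||T_i||U_i|)^{\tau/3}\le \sum_j d_j^{\tau},$$ where the $d_j$ are the dimensions of the irreducible complex representations of $G$.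
   Context: STPP constructions. An STPP construction in a finite group $G$ is a finite collection of triples of subsets $S_i,T_i,U_i\subseteq G$ satisfying the simultaneous triple product property: (1) for each $i$ and all $s,s'\in S_i$, $t,t'\in T_i$, $u,u'\in U_i$, if $s^{-1}s't^{-1}t'u^{-1}u'=1$ then $s=s'$, $t=t'$, $u=u'$; (2) for all $i,j,k$ and all $s\in S_i$, $s'\in S_j$, $t\in T_j$, $t'\in T_k$, $u\in U_k$, $u'\in U_i$, if $s^{-1}s't^{-1}t'u^{-1}u'=1$ then $i=j=k$. It is known that every STPP construction satisfies $\sum_i(|S_i||T_i||U_i|)^{\omega/3}\le\sum_j d_j^{\omega}$, where $\omega$ is the exponent of matrix multiplication and the $d_j$ are the dimensions of the irreducible complex representations of $G$. ''STPP constructions in a family cannot achieve $\omega=2$'' means that these inequalities, for all STPP constructions in groups of the family, do not imply $\omega=2$: some real $\tau\in(2,3]$ in place of $\omega$ is consistent with all of them. $p$-degrees. For a finite $p$-group $P$ the $p$-lower central series is defined by $\Gamma_1=P$ and $\Gamma_i=[P,\Gamma_{i-1}]\,\Gamma_{\lceil i/p\rceil}^{(p)}$ for $i\ge2$, where for a subgroup $H$, $H^{(p)}$ is the subgroup generated by $\{h^p:h\in H\}$. The quotients $\Gamma_j/\Gamma_{j+1}$ are $\mathbb{F}_p$-vector spaces. The length $\ell$ is the minimal $\ell$ with $\Gamma_{\ell+1}=1$. The $p$-degrees of $P$ are $r=(r_1,\dots,r_\ell)$ with $r_j=\dim_{\mathbb{F}_p}\Gamma_j/\Gamma_{j+1}$;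 if $|P|=p^n$ then $\sum_j r_j=n$. For $n\ge 1$, $X_r$ denotes the random variable taking value $i\in\{1,\dots,\ell\}$ with probability $r_i/n$. A finite nilpotent group is the direct product of its Sylow subgroups. *)

(* Defs.v *)
From HB Require Import structures.
From mathcomp Require Import all_boot all_order all_algebra.
From mathcomp Require Import all_fingroup all_solvable all_field all_character.
From mathcomp Require Import reals exp.

Set Implicit Arguments.
Unset Strict Implicit.
Unset Printing Implicit Defensive.

Import Order.TTheory GRing.Theory Num.Theory.

Section STPP.

Local Open Scope group_scope.

Definition STPP (gT : finGroupType) (G : {group gT}) (I : finType)
    (S T U : I -> {set gT}) : Prop :=
  [/\ forall i, [/\ S i \subset G, T i \subset G & U i \subset G],
      forall i s s' t t' u u',
        s \in S i -> s' \in S i -> t \in T i -> t' \in T i ->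
        u \in U i -> u' \in U i ->
        s^-1 * s' * t^-1 * t' * u^-1 * u' = 1 -> [/\ s = s', t = t' & u = u']
    & forall i j k s s' t t' u u',
        s \in S i -> s' \in S j -> t \in T j -> t' \in T k ->
        u \in U k -> u' \in U i ->
        s^-1 * s' * t^-1 * t' * u^-1 * u' = 1 -> i = j /\ j = k].

End STPP.

Section PLowerCentralSeries.

Local Open Scope group_scope.

Variable gT : finGroupType.
Implicit Types (A : {set gT}) (P H : {group gT}).

Definition ceil_div (i p : nat) : nat := ((i + p.-1) %/ p)%N.

Definition ppow_gen (p : nat) A : {set gT} := <<[set h ^+ p | h in A]>>.

(* The recursion is course-of-values, so it is run on the table               *)
(* [:: Gamma_0; ...; Gamma_n.+1], where Gamma_0 := P only pads the indexing;   *)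
(* the defining equations are plcs1 and plcsE below.                          *)
Definition plcs_step (p : nat) P (s : seq {set gT}) : seq {set gT} :=
  let i := size s in
  rcons s ([~: P, nth (P : {set gT}) s i.-1]
           * ppow_gen p (nth (P : {set gT}) s (ceil_div i p))).

Definition plcs_table (p : nat) P (n : nat) : seq {set gT} :=
  iter n (plcs_step p P) [:: P : {set gT}; P : {set gT}].

Definition plcs (p : nat) P (i : nat) : {set gT} :=
  nth (P : {set gT}) (plcs_table p P i) i.

(* l is unique, and it exists when P is a p-group: see plcs_length_exists.    *)
Definition plcs_length (p : nat) P (l : nat) : Prop :=
  plcs p P l.+1 = 1 /\ forall k : nat, plcs p P k.+1 = 1 -> (l <= k)%N.

(* The quotient is an F_p-vector space (plcs_quotient_abelem), and such a     *)
(* space of dimension r has p ^ r elements.                                   *)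
Definition pdegree (p : nat) P (j : nat) : nat :=
  logn p #|plcs p P j / plcs p P j.+1|.

(* Zero-based: the entry of index j is r_(j+1).                               *)
Definition pdegrees (p : nat) P (l : nat) : seq nat :=
  [seq pdegree p P j | j <- iota 1 l].

Lemma size_plcs_table p P n : size (plcs_table p P n) = n.+2.
Proof. by elim: n => //= n IHn; rewrite size_rcons IHn. Qed.

Lemma nth_plcs_table p P n i :
  (i <= n.+1)%N -> nth (P : {set gT}) (plcs_table p P n) i = plcs p P i.
Proof.
have stab m k j : (j <= m.+1)%N ->
    nth (P : {set gT}) (plcs_table p P (k + m)) j = nth (P : {set gT}) (plcs_table p P m) j.
  elim: k => //= k IHk lejm; rewrite -/(plcs_table p P (k + m)) nth_rcons.
  by rewrite size_plcs_table ltnS (leq_trans lejm) ?ltnS ?leq_addl ?IHk.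
move=> lein; rewrite /plcs; have [leni|ltin] := leqP n i.
  by rewrite -(subnK leni) stab // subnK.
by rewrite -(subnK (ltnW ltin)) stab.
Qed.

Lemma plcs1 p P : plcs p P 1 = P.
Proof. by rewrite -(@nth_plcs_table p P 0). Qed.

Lemma ceil_div_lt p i : (1 < p)%N -> (1 < i)%N -> (ceil_div i p < i)%N.
Proof.
move=> p1 i1; rewrite /ceil_div ltn_divLR ?(ltnW p1) //.
by case: p p1 => [|[|p]] // _; rewrite mulnS ltn_add2l ltn_Pmull.
Qed.

Lemma plcsE p P i : (1 < p)%N -> (1 < i)%N ->
  plcs p P i = [~: P, plcs p P i.-1] * ppow_gen p (plcs p P (ceil_div i p)).
Proof.
move=> p1 i1; have := ceil_div_lt p1 i1; case: i i1 => [|[|i]] //= _ lt_ci.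
rewrite -(@nth_plcs_table _ _ i.+1) //= /plcs_step -/(plcs_table p P i).
by rewrite nth_rcons size_plcs_table ltnn eqxx !nth_plcs_table.
Qed.

Lemma plcs_group p P i : (1 < p)%N ->
  exists2 H : {group gT}, plcs p P i = H & H <| P.
Proof.
move=> p1; have [n] := ubnP i; elim: n i => // n IHn [|[|i]] lein.
- by exists P.
- by exists P; rewrite ?plcs1.
have [A defA nAP] := IHn i.+1 lein.
have [|B defB nBP] := IHn (ceil_div i.+2 p).
  exact: leq_trans (ceil_div_lt p1 _) _.
have nKP: [~: P, A] <| P.
  rewrite /normal commg_subl (subset_trans (normal_sub nAP)) ?normG //.
  by rewrite normsR ?normG ?normal_norm.
have nLP: ppow_gen p B <| P.
  case/andP: nBP => sBP nBP; apply/andP; split.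
    by rewrite gen_subG; apply/subsetP=> _ /imsetP[x /(subsetP sBP) xP ->]; apply: groupX.
  apply: norms_gen; apply/subsetP=> y Py; rewrite inE; apply/subsetP=> z.
  case/imsetP=> w /imsetP[x Bx ->] ->; apply/imsetP; exists (x ^ y).
    by rewrite memJ_norm // (subsetP nBP).
  by rewrite conjXg.
exists ([~: P, A] <*> <<[set h ^+ p | h in B]>>)%G; last exact: normalY.
rewrite plcsE //= defA defB norm_joinEr //.
exact: subset_trans (normal_sub nLP) (normal_norm nKP).
Qed.

Lemma plcs_sub p P i j : (1 < p)%N -> (i <= j)%N -> plcs p P j \subset plcs p P i.
Proof.
move=> p1; have [n] := ubnP j; elim: n i j => // n IHn i j.
rewrite ltnS => lejn; case: ltngtP => // [ltij|->] _ //.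
have subP k : plcs p P k \subset P.
  by have [H -> /normal_sub] := plcs_group P k p1.
case: j lejn ltij => // j lejn; rewrite ltnS => leij.
apply: subset_trans (IHn i j lejn leij).
case: j lejn leij => [|[|j]] lejn leij; rewrite ?plcs1 //.
rewrite (@plcsE p P j.+2) // (@plcsE p P j.+3) // -!pred_Sn mulgSS //.
  by apply: commgS; apply: IHn => //; apply: ltnW.
apply: genS; apply: imsetS; apply: IHn.
  by apply: leq_trans (ceil_div_lt p1 _) _.
by rewrite /ceil_div leq_div2r // leq_add2r.
Qed.

Lemma plcs_quotient_abelem p P j : prime p -> (0 < j)%N ->
  p.-abelem (plcs p P j / plcs p P j.+1).
Proof.
move=> p_pr j0; have p1 := prime_gt1 p_pr.
have [H defH nHP] := plcs_group P j p1.
have [K defK nKP] := plcs_group P j.+1 p1.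
have defK' : K = [~: P, H] * ppow_gen p (plcs p P (ceil_div j.+1 p)) :> {set gT}.
  by rewrite -defK plcsE // -pred_Sn defH.
have sHK : [~: H, H] \subset K.
  apply: subset_trans (commSg H (normal_sub nHP)) _.
  by rewrite defK' mulG_subl.
have sHpK : ppow_gen p H \subset K.
  apply: (@subset_trans _ _ (ppow_gen p (plcs p P (ceil_div j.+1 p)))).
    apply: genS; apply: imsetS; rewrite -defH plcs_sub //.
    by rewrite -ltnS ceil_div_lt.
  by rewrite defK' mulG_subr.
rewrite defH defK abelemE // sub_der1_abelian //=.
apply/exponentP=> _ /morphimP[x Nx Hx ->].
rewrite -morphX //; apply: coset_id; apply: (subsetP sHpK).
by apply: mem_gen; apply/imsetP; exists x.
Qed.

Lemma plcs_step_proper p P H : prime p -> p.-group P -> H <| P -> H :!=: 1 ->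
  [~: P, H] * ppow_gen p H \proper H.
Proof.
move=> p_pr pP /andP[sHP nHP] ntH.
have pH := pgroupS sHP pP.
have prK: [~: P, H] \proper H.
  rewrite commGC; apply: nil_comm_properl (pgroup_nil pP) sHP ntH _.
  by rewrite subsetI subxx.
have [eqK|[M maxM sKM]] := maximal_exists (proper_sub prK).
  by rewrite eqK properxx in prK.
have nMH := p_maximal_normal pH maxM.
apply: sub_proper_trans (maxgroupp maxM).
rewrite mul_subG // gen_subG; apply/subsetP=> _ /imsetP[x Hx ->].
have Nx : x \in 'N(M) by rewrite (subsetP (normal_norm nMH)).
apply: coset_idr; first by rewrite groupX.
apply/eqP; rewrite morphX // -order_dvdn.
rewrite -(p_maximal_index pH maxM) -card_quotient ?normal_norm //.
by rewrite order_dvdG // mem_quotient.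
Qed.

Lemma plcs_length_exists p P : prime p -> p.-group P ->
  exists l, plcs_length p P l.
Proof.
move=> p_pr pP; have p1 := prime_gt1 p_pr.
suff ex1: exists l, plcs p P l.+1 == 1.
  case: (ex_minnP ex1) => l /eqP l1 minl; exists l; split=> // k /eqP.
  exact: minl.
have [k] := ubnP #|plcs p P 1|.
suff: forall N, (#|plcs p P N.+1| < k)%N -> exists l, plcs p P l.+1 == 1.
  by apply.
elim: k => // k IHk N; rewrite ltnS => leNk.
have [H defH nHP] := plcs_group P N.+1 p1.
have [H1|ntH] := eqVneq (H : {set gT}) 1; first by exists N; rewrite defH H1.
have pN: (N.+1 < N.+1 * p)%N by rewrite ltn_Pmulr.
apply: (IHk (N.+1 * p).-1); apply: leq_trans leNk.
rewrite prednK ?(leq_trans _ pN) // proper_card // defH.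
apply: sub_proper_trans (plcs_step_proper p_pr pP nHP ntH).
rewrite plcsE ?(leq_ltn_trans _ pN) // mulgSS // -?defH.
  by apply: commgS; rewrite plcs_sub // -ltnS prednK ?(leq_trans _ pN).
rewrite /ceil_div divnMDl ?(ltnW p1) // divn_small ?addn0 //.
by rewrite prednK ?(ltnW p1).
Qed.

End PLowerCentralSeries.

Section DegreeVariable.

Local Open Scope ring_scope.

Variable R : realType.
Implicit Type r : seq nat.

(* The expectation of f (X_r).                                                *)
Definition expect_X (r : seq nat) (f : nat -> R) : R :=
  \sum_(i < size r) (nth 0%N r i)%:R / (sumn r)%:R * f i.+1.

Definition EX r : R := expect_X r (fun i => i%:R).

Definition VarX r : R := expect_X r (fun i => (i%:R - EX r) ^+ 2).

End DegreeVariable.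

(* The degree of the irreducible representation 'Chi_i; MathComp takes its    *)
(* complex representations over algC, which has the same irreducible          *)
(* dimensions as the field of complex numbers.                                *)
Definition irr_dim (gT : finGroupType) (G : {group gT}) (i : Iirr G) : nat :=
  irr_degree (socle_of_Iirr i).

Definition group_family : Type := forall gT : finGroupType, {group gT} -> Prop.

Definition bounded_exponent (F : group_family) : Prop :=
  exists m : nat, forall (gT : finGroupType) (G : {group gT}),
    F gT G -> (exponent G <= m)%N.

Definition bounded_variance (R : realType) (F : group_family) : Prop :=
  exists M : R, forall (gT : finGroupType) (G : {group gT}), F gT G ->
    forall (p : nat) (P : {group gT}) (l : nat),
      prime p -> (p %| #|G|)%N -> (p.-Sylow(G) P)%g -> plcs_length p P l ->
      (VarX R (pdegrees p P l) <= M)%R.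

Definition linear_expectation (R : realType) (F : group_family) : Prop :=
  exists2 c : R, (0 < c)%R &
    forall (gT : finGroupType) (G : {group gT}), F gT G ->
    forall (p : nat) (P : {group gT}) (l : nat),
      prime p -> (p %| #|G|)%N -> (p.-Sylow(G) P)%g -> plcs_length p P l ->
      (l%:R / c <= EX R (pdegrees p P l))%R.

(* Main.v *)
Require Import Defs.
From mathcomp Require Import all_boot all_order all_algebra.
From mathcomp Require Import all_fingroup all_solvable all_field all_character.
From mathcomp Require Import reals sequences exp zify ring lra.

Set Implicit Arguments.
Unset Strict Implicit.
Unset Printing Implicit Defensive.

Import Order.TTheory GRing.Theory Num.Theory.

(* Idea. On a Sylow p-subgroup P the series Gamma_i satisfies [Gamma_a, Gamma_b] <=
   Gamma_(a+b) and Gamma_a^p <= Gamma_(pa), so products of the x - 1 with x in P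
   filter F_p[P] multiplicatively, and the monomials in the g_k - 1 (exponents < p,
   g_k of weight w_k adapted to the series) describe this filtration; it vanishes
   above W = (p - 1) * sum w_k (Jennings). Extend it to F_p[G], where P is normal.
   An STPP construction makes the trilinear form (a, b, c) |-> coefficient of 1 in abc
   restrict to a direct sum of matrix multiplication tensors, whose support is an
   antichain for suitable total orders. Triangular elimination along these orders
   attaches to the rows a filtration degree so that degrees add up to at most W on
   the support, while at most codim J_v of them are below v. With n_i = |S_i||T_i||U_i|,
   the AM-GM inequality over each block then gives, for every 0 < lam <= 1,
     sum_i n_i^(2/3) * lam^(W/3) <= |G : P| * prod_k (1 + lam^w_k + ... + lam^((p-1)w_k)).
   Optimizing lam bounds sum_i n_i^(2/3) by |G| exp(- c n), |P| = p^n, as soon as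
   n * sum w_k^2 = O((sum w_k)^2), which is what bounded variance or linear
   expectation say. As the exponent is bounded, some Sylow subgroup has order at
   least a fixed power of |G|; the gain absorbs a small increase of the exponent
   2/3, and sum_j d_j^tau >= sum_j d_j^2 = |G|. *)

(** * The p-lower central series *)

Section PLowerCentralSeriesTheory.

Local Open Scope group_scope.

Section CommutingProducts.

Variable gT : finGroupType.

(* The operator form of Pascal's rule: conjugation by [x] acts on the commuting
   elements [z i] as [1 + shift]. *)
Lemma conjg_expg_binomial (x : gT) (z : nat -> gT) n :
    (forall i, z i ^ x = z i * z i.+1) -> (forall i j, commute (z i) (z j)) ->
  z 0 ^ (x ^+ n) = \prod_(i < n.+1) z i ^+ 'C(n, i).
Proof.
move=> zx cz; elim: n => [|n IHn]; first by rewrite conjg1 big_ord1 expg1.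
pose f i := z i ^+ 'C(n, i); pose g i := if i is j.+1 then z i ^+ 'C(n, j) else 1.
rewrite expgSr conjgM IHn.
have -> : (\prod_(i < n.+1) z i ^+ 'C(n, i)) ^ x =
    (\prod_(i < n.+1) f i) * \prod_(i < n.+1) g i.+1.
  rewrite -prodgM_commute => [|i j _ _]; last by apply/commuteX2/cz.
  elim: n.+1 {IHn} => [|m IHm]; first by rewrite !big_ord0 conj1g.
  rewrite !big_ord_recr /= conjMg {}IHm; congr (_ * _).
  by rewrite conjXg zx expgMn.
have -> : \prod_(i < n.+1) f i = \prod_(i < n.+2) f i.
  by rewrite [RHS]big_ord_recr /= /f bin_small // mulg1.
have -> : \prod_(i < n.+1) g i.+1 = \prod_(i < n.+2) g i.
  by rewrite [RHS]big_ord_recl /= mul1g.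
rewrite -prodgM_commute => [|i j _ _]; last first.
  by case: j => -[|j] ltj /=; [apply: commute1 | apply/commuteX2/cz].
apply: eq_bigr => -[[|i] _] _ /=; rewrite /f /g; first by rewrite mulg1 !bin0.
by rewrite -expgnDr binS.
Qed.

End CommutingProducts.

Variables (gT : finGroupType) (p : nat) (P : {group gT}).
Hypothesis p_pr : prime p.

Let p_gt1 : (1 < p)%N := prime_gt1 p_pr.

(** [plcs] is only a set; generating packages it as a group and changes nothing ([plcs_gpE]). *)
Definition plcs_gp i : {group gT} := <<plcs p P i>>%G.

Lemma plcs_gpE i : plcs_gp i = plcs p P i :> {set gT}.
Proof.
by have [H defH _] := plcs_group P i p_gt1; rewrite /= defH genGid.
Qed.

Local Notation D := plcs_gp.

Lemma plcs_gp0 : D 0 = P :> {set gT}. Proof. exact: plcs_gpE. Qed.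

Lemma plcs_gp1 : D 1 = P :> {set gT}. Proof. by rewrite plcs_gpE plcs1. Qed.

Lemma plcs_gp_anti i j : (i <= j)%N -> D j \subset D i.
Proof. by rewrite !plcs_gpE; apply: plcs_sub. Qed.

Lemma plcs_gp_sub i : D i \subset P.
Proof. by rewrite -plcs_gp0 plcs_gp_anti. Qed.

Lemma plcs_gp_normal i : D i <| P.
Proof.
by have [H defH nHP] := plcs_group P i p_gt1; rewrite /normal !plcs_gpE defH.
Qed.

Lemma plcs_gpS i : (0 < i)%N ->
  D i.+1 = [~: P, D i] * ppow_gen p (D (ceil_div i.+1 p)) :> {set gT}.
Proof. by move=> i0; rewrite !plcs_gpE (plcsE P p_gt1). Qed.

Lemma plcs_gp_comm1 i : [~: P, D i] \subset D i.+1.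
Proof.
case: i => [|i]; last by rewrite [D i.+2 : {set _}]plcs_gpS // mulG_subl.
by rewrite plcs_gp0 der1_subG.
Qed.

(** For positive i the ceiling of p i / p is i, so the recursion at index p i adjoins exactly the
    p-th powers of [D i]. *)
Lemma plcs_gp_expg i x : x \in D i -> x ^+ p \in D (p * i).
Proof.
case: i => [|i] Dx; first by rewrite muln0 groupX.
have lt1 : (1 < p * i.+1)%N by rewrite (leq_trans p_gt1) // leq_pmulr.
rewrite -(prednK (ltnW lt1)) plcs_gpS; last by rewrite -ltnS prednK // ltnW.
rewrite prednK ?(ltnW lt1) //; apply: (subsetP (mulG_subr _ _)).
rewrite /ceil_div mulnC divnMDl ?(ltnW p_gt1) // divn_small ?addn0; last first.
  by rewrite prednK // ltnW.
by apply: mem_gen; apply/imsetP; exists x.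
Qed.

(** The recursion only uses operations that commute with conjugation. This serves for elements of G
    outside P, which act on the algebra of P. *)
Lemma plcs_gp_norm h i : h \in 'N(P) -> h \in 'N(D i).
Proof.
move=> nPh; have [n] := ubnP i; elim: n i => // n IHn [|[|i]] ltin.
- by rewrite plcs_gp0.
- by rewrite plcs_gp1.
have nDi := IHn i.+1 ltin.
have nDc := IHn _ (leq_trans (ceil_div_lt p_gt1 (isT : 1 < i.+2)%N) ltin).
apply/normP; rewrite plcs_gpS // conjsMg conjsRg (normP nPh) (normP nDi).
congr (_ * _); rewrite /ppow_gen -genJ; congr <<_>>.
apply/setP=> y; rewrite mem_conjg; apply/imsetP/imsetP=> -[x Dx def_y].
  exists (x ^ h); first by rewrite memJ_norm.
  by rewrite -conjXg -def_y conjgKV.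
exists (x ^ h^-1); first by rewrite memJ_norm ?groupV.
by rewrite def_y conjXg.
Qed.

Lemma leq_ceil_div_mul i : (i <= p * ceil_div i p)%N.
Proof.
rewrite /ceil_div mulnC; have := divn_eq (i + p.-1) p.
move=> e; have := ltn_pmod (i + p.-1) (ltnW p_gt1); rewrite -ltnS => lt.
have : (i + p.-1 <= (i + p.-1) %/ p * p + p.-1)%N.
  by rewrite {1}e leq_add2l -ltnS prednK // ltnW.
by rewrite leq_add2r.
Qed.

(** Induction on the smaller index. Modulo [N], the factor [P, D_(a+1)] of D_(a+2) is handled by the
    three subgroup lemma, and the factor of p-th powers by a binomial expansion of conjugation by
    x^p. *)
Lemma plcs_gp_comm a b : [~: D a, D b] \subset D (a + b).
Proof.
have [n] := ubnP a; elim: n a b => // n IHn a b.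
case: a => [|[|a]] ltan.
- by rewrite plcs_gp0 (subset_trans (plcs_gp_comm1 b)) ?plcs_gp_anti.
- by rewrite plcs_gp1 plcs_gp_comm1.
have [ltba|leab] := ltnP b a.+2.
  by rewrite commGC addnC; apply: IHn; apply: leq_trans ltba _.
have Sa b' : [~: D a.+1, D b'] \subset D (a.+1 + b') by apply: IHn.
set c := ceil_div a.+2 p.
have c_gt0 : (0 < c)%N.
  by have := leq_ceil_div_mul a.+2; rewrite -/c; case: (c) => //; rewrite muln0.
have Sc b' : [~: D c, D b'] \subset D (c + b').
  by apply: IHn; apply: leq_trans (ceil_div_lt p_gt1 (isT : 1 < a.+2)%N) _.
set N := D (a.+2 + b).
have nN i : D i \subset 'N(N).
  exact: subset_trans (plcs_gp_sub i) (normal_norm (plcs_gp_normal _)).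
have nPN : P \subset 'N(N) by rewrite -plcs_gp0 nN.
rewrite -quotient_cents2 ?nN // (plcs_gpS (isT : 0 < a.+1)%N) -/c.
have nR : [~: P, D a.+1] \subset 'N(N).
  exact: subset_trans (plcs_gp_comm1 _) (nN _).
rewrite quotientMl // mul_subG //; last first.
  rewrite /ppow_gen quotient_gen; last first.
    by apply/subsetP=> _ /imsetP[x Dx ->]; rewrite groupX // (subsetP (nN c)).
  rewrite gen_subG; apply/subsetP=> _ /morphimP[_ _ /imsetP[x Dx ->] ->].
  apply/centP=> _ /morphimP[y Ny Dy ->].
  have Nx : x \in 'N(N) by apply: subsetP Dx.
  rewrite morphX //.
  (* Conjugation by x sends z_i to z_i z_(i+1), so [conjg_expg_binomial] applies modulo [N]. *)
  pose z i := iter i (fun t => [~ t, x]) y.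
  have Dz i : z i \in D (b + i * c).
    elim: i => [|i IHi]; first by rewrite addn0.
    rewrite mulSn addnCA; apply: (subsetP (Sc _)); rewrite commGC.
    exact: mem_commg.
  have Nz i : z i \in 'N(N) by apply: subsetP (Dz i).
  have zx i : coset N (z i) ^ coset N x = coset N (z i) * coset N (z i.+1).
    by rewrite -morphJ // conjg_mulR morphM //= groupR.
  (* For i < j, z i lies in [D a.+1] and z j in [D (b + c)] with c > 0, so their
     commutator is in N by the induction hypothesis at a.+1. *)
  have cz i j : commute (coset N (z i)) (coset N (z j)).
    wlog lt_ij : i j / (i < j)%N.
      move=> W; case: (ltngtP i j) => [/W // | /W /commute_sym // | -> //].
    apply/commgP; rewrite -morphR //; apply/eqP/coset_id.
    apply: subsetP (mem_commg (subsetP (plcs_gp_anti _) _ (Dz i))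
                              (subsetP (plcs_gp_anti _) _ (Dz j))).
    - apply: subset_trans (Sa (b + c)) (plcs_gp_anti _).
      lia.
    - exact: leq_trans (leq_trans (leqnSn _) leab) (leq_addr _ _).
    - by rewrite leq_add2l leq_pmull // (leq_ltn_trans _ lt_ij).
  apply/commute_sym/commgP/eqP; rewrite commgEl.
  rewrite (@conjg_expg_binomial _ _ (fun i => coset N (z i))) //.
  (* All factors past i = 0 vanish modulo [N]: for i = p because p c >= a + 2, and for 0 < i < p
     because p divides the binomial coefficient and z_i^p has weight at least p (b + i c). *)
  rewrite big_ord_recl bin0 expg1 mulKg big1 // => i _; rewrite lift0.
  have lec := leq_ceil_div_mul a.+2; rewrite -/c in lec.
  have [lt_i1p|] := ltnP i.+1 p; last first.
    move=> le_pi; have -> : i.+1 = p by apply/eqP; rewrite eqn_leq ltn_ord.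
    rewrite binn expg1; apply/coset_id/(subsetP (plcs_gp_anti _) _ (Dz p)).
    by rewrite addnC leq_add2l.
  have /(prime_dvd_bin p_pr)/dvdnP[q ->] : (0 < i.+1 < p)%N by [].
  rewrite mulnC expgM (_ : coset N (z i.+1) ^+ p = 1) ?expg1n // -morphX //.
  apply/coset_id/(subsetP (plcs_gp_anti _) _ (plcs_gp_expg (Dz i.+1))).
  rewrite mulnDr addnC leq_add ?leq_pmull ?(ltnW p_gt1) //.
  by rewrite (leq_trans lec) // leq_mul2l leq_pmull ?orbT.
rewrite (sameP commG1P eqP) quotientR //.
have q3 (X Y Z : {group gT}) : X \subset P -> Y \subset P -> Z \subset P ->
    [~: X, Y, Z] \subset N -> [~: X / N, Y / N, Z / N] = 1.
  move=> sXP sYP sZP /quotientS1 <-.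
  have sXYP : [~: X, Y] \subset P.
    exact: subset_trans (commgSS sXP sYP) (der1_subG P).
  by rewrite !quotientR ?(subset_trans _ nPN).
apply/eqP/three_subgroup; apply: q3; rewrite ?plcs_gp_sub //.
  apply: subset_trans (commSg _ (Sa b)) _.
  by rewrite commGC; apply: plcs_gp_comm1.
apply: (@subset_trans _ _ [~: D b.+1, D a.+1]).
  by rewrite commSg // commGC plcs_gp_comm1.
by rewrite commGC (subset_trans (Sa _)) // addnS.
Qed.

End PLowerCentralSeriesTheory.

(** * The Jennings filtration of a group algebra *)

Lemma mem_sub (T : finType) (A B : {set T}) x : A \subset B -> x \in A -> x \in B.
Proof. by move/subsetP; apply. Qed.

Lemma dimv_sum_leq (F : fieldType) (V : vectType F) (I : Type) (r : seq I)
    (Q : pred I) (U : I -> {vspace V}) (n : I -> nat) :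
    (forall i, Q i -> (\dim (U i) <= n i)%N) ->
  (\dim (\sum_(i <- r | Q i) U i) <= \sum_(i <- r | Q i) n i)%N.
Proof.
move=> leUn; apply: (big_ind2 (fun (W : {vspace V}) k => \dim W <= k)%N) => //.
  by rewrite dimv0.
move=> W k W' k' leWk leWk'; apply: leq_trans (dimv_add_leqif W W') _.
exact: leq_add.
Qed.

Lemma limg_dim_leq (F : fieldType) (V W : vectType F) (f : 'Hom(V, W)) U :
  (\dim (f @: U) <= \dim U)%N.
Proof. by rewrite -(limg_ker_dim f U) leq_addl. Qed.

(** The exponents, with multiplicity, in the expansion of the product over w of 1 + t^w + ... +
    t^((p-1)w). *)
Fixpoint monomial_weights (p : nat) (ws : seq nat) : seq nat :=
  if ws is w :: ws' then
    [seq (i * w + t)%N | i <- iota 0 p, t <- monomial_weights p ws']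
  else [:: 0%N].

Lemma count_monomial_weights p w ws v :
  count (fun t => t < v)%N (monomial_weights p (w :: ws)) =
  (\sum_(i < p) count (fun t => t < v - i * w) (monomial_weights p ws))%N.
Proof.
rewrite count_flatten -map_comp sumnE big_map -{1}[p]subn0 -/(index_iota 0 p).
rewrite big_mkord; apply: eq_bigr => i _ /=; rewrite count_map.
by apply: eq_count => t /=; lia.
Qed.

Section JenningsFiltration.

Local Open Scope ring_scope.

Variables (p : nat) (F : fieldType) (A : falgType F) (gT : finGroupType).
Variable rho : gT -> A.
Hypothesis pcharFp : p \in [pchar F].
Hypothesis rho1 : rho 1%g = 1.
Hypothesis rhoM : {morph rho : x y / (x * y)%g >-> x * y}.

Let p_pr : prime p := pcharf_prime pcharFp.

Variable D : nat -> {group gT}.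
Hypothesis D_anti : forall i j, (i <= j)%N -> D j \subset D i.
Hypothesis D_comm : forall i j, [~: D i, D j]%g \subset D (i + j).
Hypothesis D_expg : forall i x, x \in D i -> (x ^+ p)%g \in D (p * i).

Local Notation aug x := (rho x - 1).

(* The span of the products of factors [rho x - 1], x in N, of total weight at least
   v, where such a factor may be given any weight u with x in [D u]. *)
Inductive aug_filt (N : {set gT}) : nat -> A -> Prop :=
| aug_filt_zero v : aug_filt N v 0
| aug_filt_one : aug_filt N 0 1
| aug_filt_lin v c a b :
    aug_filt N v a -> aug_filt N v b -> aug_filt N v (c *: a + b)
| aug_filt_aug x u v a : x \in N -> x \in D u -> aug_filt N v a ->
    aug_filt N (u + v) (aug x * a)
| aug_filt_le v v' a : (v <= v')%N -> aug_filt N v' a -> aug_filt N v a.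

Local Notation J := aug_filt.

Lemma rhoV x : rho x^-1%g * rho x = 1.
Proof. by rewrite -rhoM mulVg. Qed.

Lemma rhoVr x : rho x * rho x^-1%g = 1.
Proof. by rewrite -rhoM mulgV. Qed.

Lemma rhoX x n : rho (x ^+ n)%g = rho x ^+ n.
Proof. by elim: n => [|n IHn]; rewrite ?rho1 // expgS exprS rhoM IHn. Qed.

Lemma rhoJ x y : rho (x ^ y)%g = rho y^-1%g * rho x * rho y.
Proof. by rewrite -!rhoM conjgE mulgA. Qed.

Lemma aug_filtD N v a b : J N v a -> J N v b -> J N v (a + b).
Proof. by move=> Ja Jb; rewrite -[a]scale1r; apply: aug_filt_lin. Qed.

Lemma aug_filtZ N v c a : J N v a -> J N v (c *: a).
Proof. by move=> Ja; rewrite -[_ *: _]addr0; apply/aug_filt_lin/aug_filt_zero. Qed.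

Lemma aug_filtM N u v a b : J N u a -> J N v b -> J N (u + v) (a * b).
Proof.
move=> Ja; elim: Ja v b => {u a} [u|| u c a a' _ IHa _ IHa'|x u u' a Nx Dx _ IHa
    |u u' a le_u _ IHa] v b Jb.
- by rewrite mul0r; apply: aug_filt_zero.
- by rewrite mul1r.
- by rewrite mulrDl -scalerAl; apply: aug_filt_lin; [apply: IHa | apply: IHa'].
- by rewrite -mulrA -addnA; apply: aug_filt_aug => //; apply: IHa.
- by apply: (@aug_filt_le _ _ (u' + v)); [rewrite leq_add2r | apply: IHa].
Qed.

Lemma aug_filt_gen (N : {set gT}) u x : x \in N -> x \in D u -> J N u (aug x).
Proof.
by move=> Nx Dx; rewrite -[aug x]mulr1 -[u]addn0; apply/aug_filt_aug/aug_filt_one.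
Qed.

Lemma aug_filt_rho (N : {set gT}) x : N \subset D 0 -> x \in N -> J N 0 (rho x).
Proof.
move=> sND Nx; rewrite -[rho x](subrK 1); apply: aug_filtD (aug_filt_one _).
by apply: aug_filt_gen => //; apply: subsetP Nx.
Qed.

Lemma aug_filtS (N N' : {set gT}) v a : N' \subset N -> J N' v a -> J N v a.
Proof.
move=> sN; elim=> {v a} [v||v c a b _ Ja _ Jb|x u v a Nx Dx _ Ja|u v a le_uv _ Ja].
- exact: aug_filt_zero.
- exact: aug_filt_one.
- exact: aug_filt_lin.
- by apply: aug_filt_aug => //; apply: subsetP Nx.
- exact: aug_filt_le Ja.
Qed.

Lemma aug_filt_conj (N : {set gT}) v a h :
    h \in 'N(N)%g -> (forall u, h \in 'N(D u)%g) ->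
  J N v a -> J N v (rho h^-1%g * a * rho h).
Proof.
move=> nNh nDh; elim=> {v a} [v||v c a b _ Ja _ Jb|x u v a Nx Dx _ Ja|u v a le_uv _ Ja].
- by rewrite mulr0 mul0r; apply: aug_filt_zero.
- by rewrite mulr1 rhoV; apply: aug_filt_one.
- rewrite mulrDr -scalerAr mulrDl -scalerAl; exact: aug_filt_lin.
- have -> : rho h^-1%g * (aug x * a) * rho h =
    aug (x ^ h)%g * (rho h^-1%g * a * rho h).
    rewrite rhoJ !mulrBl !mul1r !mulrBr !mulrBl !mulrA; congr (_ - _).
    by rewrite -!(mulrA _ (rho h)) rhoVr mulr1 -!mulrA.
  by apply: aug_filt_aug; rewrite ?memJ_norm.
- exact: aug_filt_le Ja.
Qed.

Lemma memR_norm (N : {group gT}) x g :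
  x \in N -> g \in 'N(N)%g -> [~ x, g]%g \in N.
Proof. by move=> Nx nNg; rewrite commgEl groupM ?groupV // memJ_norm. Qed.

(** On a generator, x^g - x = x ([x, g] - 1), and [x, g] has weight u + w; products follow by a
    Leibniz rule. *)
Lemma aug_filt_conjB (N : {group gT}) u w a g :
    g \in 'N(N)%g -> g \in D w -> N \subset D 0 ->
  J N u a -> J N (u + w) (rho g^-1%g * a * rho g - a).
Proof.
move=> nNg Dg sND.
have nDg v : g \in 'N(D v)%g.
  have D0g : g \in D 0 by apply: (mem_sub _ Dg); apply: D_anti.
  apply: (mem_sub _ D0g); rewrite -commg_subr; apply: D_comm.
elim=> {u a} [v||v c a b _ Ja _ Jb|x u v a Nx Dx Jva Ja|u v a le_uv _ Ja].
- by rewrite mulr0 mul0r subr0; apply: aug_filt_zero.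
- by rewrite mulr1 rhoV subrr; apply: aug_filt_zero.
- rewrite mulrDr -scalerAr mulrDl -scalerAl opprD addrACA -scalerBr.
  exact: aug_filt_lin.
- have Ja' := aug_filt_conj nNg nDg Jva.
  have -> : rho g^-1%g * (aug x * a) * rho g - aug x * a =
      aug (x ^ g)%g * (rho g^-1%g * a * rho g - a) + (rho (x ^ g)%g - rho x) * a.
    have -> : rho g^-1%g * (aug x * a) * rho g =
      aug (x ^ g)%g * (rho g^-1%g * a * rho g).
      rewrite rhoJ !mulrBl !mul1r !mulrBr !mulrBl !mulrA; congr (_ - _).
      by rewrite -!(mulrA _ (rho g)) rhoVr mulr1 -!mulrA.
    rewrite mulrBr -addrA; congr (_ + _); rewrite -!mulNr -mulrDl.
    by rewrite !opprB addrA subrK.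
  apply: aug_filtD.
    by rewrite -addnA; apply: aug_filt_aug; rewrite ?memJ_norm.
  rewrite addnAC; apply: aug_filtM Jva.
  have -> : rho (x ^ g)%g - rho x = rho x * aug [~ x, g]%g.
    by rewrite mulrBr mulr1 -rhoM conjg_mulR.
  rewrite -[(u + w)%N]add0n; apply: aug_filtM; first exact: aug_filt_rho.
  apply: aug_filt_gen; first exact: memR_norm.
  by apply: (mem_sub (D_comm u w)); apply: mem_commg.
- by apply: aug_filt_le Ja; rewrite leq_add2r.
Qed.

(* The span of the monomials [\prod_k (rho g_k - 1) ^+ i_k] with [i_k < p] and
   [\sum_k i_k * w_k >= v]; truncated subtraction makes an exhausted bound 0. *)
Fixpoint jennings (L : seq (gT * nat)) (v : nat) : {vspace A} :=
  if L is (g, w) :: L' then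
    (\sum_(i < p) amull (aug g ^+ i) @: jennings L' (v - i * w))%VS
  else if v == 0 then <[1]>%VS else 0%VS.

Local Notation K := jennings.

(* A chain with steps of index at most p, refining [D]: the generator g has weight w
   when it is added between [D w.+1] and [D w]. *)
Inductive pchain : {group gT} -> seq (gT * nat) -> Prop :=
| pchain_nil : pchain 1%G [::]
| pchain_cons (N' N : {group gT}) L g w : pchain N' L ->
    (0 < w)%N -> N' \subset N -> g \in N -> N \subset D w -> D w.+1 \subset N' ->
    N \subset (<[g]> * N')%g -> pchain N ((g, w) :: L).

Lemma jennings_ind g w L v (Q : A -> Prop) :
    Q 0 -> (forall a b, Q a -> Q b -> Q (a + b)) ->
    (forall i b, (i < p)%N -> b \in K L (v - i * w) -> Q (aug g ^+ i * b)) ->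
  forall a, a \in K ((g, w) :: L) v -> Q a.
Proof.
move=> Q0 QD Qg a /memv_sumP[b Kb ->]; apply: big_ind => // i _.
by have /memv_imgP[c Kc ->] := Kb i isT; rewrite lfunE; apply: Qg.
Qed.

Lemma mem_jennings g w L v i b : (i < p)%N -> b \in K L (v - i * w) ->
  aug g ^+ i * b \in K ((g, w) :: L) v.
Proof.
move=> lt_ip Kb; apply: subvP (sumv_sup (Ordinal lt_ip) _ (subvv _)) _ _ => //=.
by rewrite (_ : _ * b = amull (aug g ^+ i) b) ?memv_img // lfunE.
Qed.

Lemma jennings_anti L u v : (u <= v)%N -> (K L v <= K L u)%VS.
Proof.
elim: L u v => [|[g w] L IHL] u v le_uv /=.
  by case: eqP le_uv => [->|_]; [rewrite leqn0 => -> | rewrite sub0v].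
apply/subv_sumP => i _; apply: (sumv_sup i) => //; apply: limgS.
by apply: IHL; apply: leq_sub2r.
Qed.

(** Frobenius is additive on the commuting elements [rho x] and 1. *)
Lemma aug_expp x : aug x ^+ p = aug (x ^+ p)%g.
Proof.
have pcharAp : p \in [pchar A] by rewrite pchar_lalg.
have := pFrobenius_autB_comm pcharAp (GRing.commr1 (rho x)).
by rewrite !pFrobenius_autE expr1n rhoX.
Qed.

Lemma jennings_sub_aug_filt N L v a : pchain N L -> a \in K L v -> J N v a.
Proof.
move=> cL; elim: cL v a => {N L} [v a|N' N L g w _ IHL w0 sN Ng sND _ _ v a].
  rewrite /=; case: eqP => [->|_] => [/vlineP[c ->]|]; first exact/aug_filtZ/aug_filt_one.
  by rewrite memv0 => /eqP ->; apply: aug_filt_zero.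
apply: jennings_ind => [||i b _ /IHL Jb]; first exact: aug_filt_zero.
  exact: aug_filtD.
have Jg : J N (i * w) (aug g ^+ i).
  elim: i {Jb} => [|i IHi]; first exact: aug_filt_one.
  by rewrite exprS mulSn; apply: aug_filt_aug => //; apply: subsetP sND _ Ng.
apply: aug_filt_le (aug_filtM Jg (aug_filtS sN Jb)); lia.
Qed.

(** * One step of the chain: from N' to <g> N' *)

Section Extension.

Variables (N' N : {group gT}) (L : seq (gT * nat)) (g : gT) (w : nat).
Hypotheses (w0 : (0 < w)%N) (sN'N : N' \subset N) (Ng : g \in N).
Hypotheses (sND : N \subset D w) (sDN' : D w.+1 \subset N').
Hypothesis sNgN' : N \subset (<[g]> * N')%g.
Hypothesis KL : forall v a, a \in K L v <-> J N' v a.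

Local Notation S := (K ((g, w) :: L)).

Let Dg : g \in D w := subsetP sND g Ng.

Let nN'g : g \in 'N(N')%g.
Proof.
apply: (mem_sub _ Dg); rewrite -commg_subl.
apply: subset_trans (commSg _ (subset_trans sN'N sND)) (subset_trans (D_comm _ _) _).
by apply: subset_trans sDN'; apply: D_anti; rewrite -addn1 leq_add2l.
Qed.

Let sN'D0 : N' \subset D 0.
Proof.
exact: subset_trans sN'N (subset_trans sND (D_anti (leq0n w))).
Qed.

(** Only the top power of g - 1 needs care: (g - 1)^p = g^p - 1, and g^p has weight p w > w, so it
    lies in N' and is absorbed by the monomials of [L]. *)
Lemma jennings_augM v a : a \in S v -> aug g * a \in S (v + w).
Proof.
move: a; apply: (jennings_ind (Q := fun a => aug g * a \in S (v + w))).
- by rewrite mulr0 mem0v.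
- by move=> b c Sb Sc; rewrite mulrDr memvD.
move=> i b lt_ip Kb; rewrite mulrA -exprS; have [lt_i1p|] := ltnP i.+1 p.
  by apply: mem_jennings => //; rewrite mulSn addnC subnDl.
move=> le_pi; have def_p : i.+1 = p by apply/eqP; rewrite eqn_leq lt_ip.
rewrite {1}def_p aug_expp -[_ * b]mul1r -[1](expr0 (aug g)).
apply: mem_jennings; first exact: prime_gt0.
apply/KL; apply: (@aug_filt_le _ _ (p * w + (v - i * w))).
  by rewrite mul0n subn0 -def_p mulSn -addnA addnC leq_add2l -leq_subLR.
apply: aug_filtM; last exact/KL.
have Dgp := D_expg Dg; apply: aug_filt_gen => //.
apply: (mem_sub sDN'); apply: (mem_sub _ Dgp); apply: D_anti.
exact: ltn_Pmull (prime_gt1 p_pr) w0.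
Qed.

(* Moving [c] to the right of [g] replaces it by [c ^ g], which differs from [c] by an
   element of filtration degree larger by [w]. *)
Lemma jennings_straighten i u v c b :
  J N' u c -> b \in K L v -> c * aug g ^+ i * b \in S (u + v + i * w).
Proof.
move=> Jc Kb; elim: i u c Jc => [|i IHi] u c Jc.
  rewrite -mulrA mul1r -[c * b]mul1r -[1](expr0 (aug g)).
  apply: mem_jennings; first exact: prime_gt0.
  by rewrite subn0 addn0; apply/KL/aug_filtM => //; apply/KL.
have Jd := aug_filt_conjB nN'g Dg sN'D0 Jc.
set d := _ - c in Jd.
have -> : c * aug g ^+ i.+1 = aug g * (c * aug g ^+ i) +
    (aug g * (d * aug g ^+ i) + d * aug g ^+ i).
  rewrite exprS !mulrA -!mulrDl; congr (_ * _).
  have gd : rho g * d = c * rho g - rho g * c.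
    by rewrite /d mulrBr !mulrA rhoVr mul1r.
  rewrite [_ * d]mulrBl mul1r subrK gd mulrBr mulr1 mulrBl mul1r.
  by rewrite [RHS]addrC addrA subrK.
rewrite !(mulrDl _ _ b) -!(mulrA (aug g) _ b) !memvD //.
- by rewrite mulSn (addnC w) addnA; apply/jennings_augM/IHi.
- apply: subvP (jennings_anti _ _) _ (jennings_augM (IHi _ _ Jd)).
  by rewrite mulSn addnA (addnAC u w v) leq_addr.
- apply: subvP (jennings_anti _ _) _ (IHi _ _ Jd).
  by rewrite mulSn addnA (addnAC u w v).
Qed.

(** If u > w, then x lies in N' and straightening applies. If u <= w, it suffices to gain w: write x
    = g^j y with y in N' and use yz - 1 = (y - 1)(z - 1) + (y - 1) + (z - 1). *)
Lemma jennings_aug x u v a : x \in N -> x \in D u -> a \in S v ->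
  aug x * a \in S (u + v).
Proof.
have N'case y t v' b : y \in N' -> y \in D t -> b \in S v' -> aug y * b \in S (t + v').
  move=> N'y Dy; move: b.
  apply: (jennings_ind (Q := fun b => aug y * b \in S (t + v'))) => [|c d|i c _ Kc].
  - by rewrite mulr0 mem0v.
  - by move=> Sc Sd; rewrite mulrDr memvD.
  rewrite mulrA; apply: subvP (jennings_anti _ _) _
    (jennings_straighten i (aug_filt_gen N'y Dy) Kc).
  by rewrite -addnA leq_add2l addnC -leq_subLR.
move=> Nx Dx Sa; have [lt_wu|le_uw] := ltnP w u.
  by apply: N'case => //; apply: (mem_sub sDN'); apply: (mem_sub _ Dx); apply: D_anti.
apply: (subvP (jennings_anti _ (_ : u + v <= w + v)%N)); first by rewrite leq_add2r.
pose Q y := forall v b, b \in S v -> aug y * b \in S (w + v).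
have QM y z : Q y -> Q z -> Q (y * z)%g.
  move=> Qy Qz v' b Sb.
  have -> : aug (y * z)%g * b = aug y * (aug z * b) + (aug y * b + aug z * b).
    rewrite mulrA -!mulrDl; congr (_ * _).
    by rewrite rhoM mulrBr mulr1 [aug y * rho z]mulrBl mul1r [RHS]addrA subrK addrA subrK.
  apply: memvD; last by apply: memvD; [apply: Qy | apply: Qz].
  by apply: subvP (jennings_anti _ (leq_addl w _)) _ _; apply/Qy/Qz.
have Qg : Q g by move=> v' b; rewrite addnC; apply: jennings_augM.
have : x \in (<[g]> * N')%g by apply: subsetP Nx.
case/mulsgP=> _ y /cycleP[j ->] N'y ->; apply: (QM) => //.
  elim: j => [|j IHj]; first by move=> v' b _; rewrite rho1 subrr mul0r mem0v.
  by rewrite expgS; apply: (QM).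
by move=> v' b; apply: N'case => //; apply: (mem_sub sND); apply: subsetP N'y.
Qed.

End Extension.

(** With the converse inclusion, this identifies the monomial spans with the filtration. The spans
    control dimensions and vanishing, the filtration gives multiplicativity and invariance under
    conjugation. *)
Lemma aug_filt_sub_jennings N L v a : pchain N L -> J N v a -> a \in K L v.
Proof.
move=> cL; elim: cL v a => {N L} [|N' N L g w cL IHL w0 sN Ng sND sDN' sNg] v a.
  elim=> {v a} [v||v c a b _ Ka _ Kb|x u v a Nx _ _ _|u v a le_uv _ Ka].
  - exact: mem0v.
  - exact: memv_line.
  - by rewrite memvD ?memvZ.
  - by have /set1P-> := Nx; rewrite rho1 subrr mul0r mem0v.
  - exact: subvP (jennings_anti _ le_uv) _ Ka.
have KL v' b : b \in K L v' <-> J N' v' b.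
  by split; [apply: jennings_sub_aug_filt | apply: IHL].
elim=> {v a} [v||v c a b _ Ka _ Kb|x u v a Nx Dx _ Ka|u v a le_uv _ Ka].
- exact: mem0v.
- rewrite -[1]mulr1 -{1}(expr0 (aug g)); apply: mem_jennings.
    exact: prime_gt0.
  by apply/KL/aug_filt_one.
- by rewrite memvD ?memvZ.
- exact: (jennings_aug w0 sN Ng sND sDN' sNg KL Nx Dx Ka).
- exact: subvP (jennings_anti _ le_uv) _ Ka.
Qed.

Lemma jennings_eq0 L v : ((p.-1) * sumn (unzip2 L) < v)%N -> K L v = 0%VS.
Proof.
elim: L v => [|[g w] L IHL] v /=; first by rewrite muln0; case: v.
move=> ltv; rewrite big1 // => i _; rewrite IHL ?limg0 //.
have : (i * w <= p.-1 * w)%N.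
  by rewrite leq_mul2r -ltnS prednK ?ltn_ord ?orbT ?prime_gt0.
lia.
Qed.

(** The leaf condition is opposite to that of [jennings], so this spans the monomials of weight
    below v; their number bounds the codimension of [jennings L v]. *)
Fixpoint low_monomials (L : seq (gT * nat)) (v : nat) : {vspace A} :=
  if L is (g, w) :: L' then
    (\sum_(i < p) amull (aug g ^+ i) @: low_monomials L' (v - i * w))%VS
  else if v == 0 then 0%VS else <[1]>%VS.

Lemma dim_low_monomials L v :
  (\dim (low_monomials L v) <=
     count (fun t => t < v)%N (monomial_weights p (unzip2 L)))%N.
Proof.
elim: L v => [|[g w] L IHL] v.
  by case: v => [|v]; rewrite /= ?dimv0 ?dim_vline ?oner_neq0.
rewrite [unzip2 _]/= count_monomial_weights; apply: dimv_sum_leq => i _.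
exact: leq_trans (limg_dim_leq _ _) (IHL _).
Qed.

Lemma jennings_sub_low L v : (K L 0 <= low_monomials L v + K L v)%VS.
Proof.
elim: L v => [|[g w] L IHL] v /=; first by case: eqP; rewrite ?addvSr ?addvSl.
rewrite -big_split /=; apply/subv_sumP => i _; apply: (sumv_sup i) => //.
by rewrite -limgD limgS // sub0n.
Qed.

(** * The filtration on the algebra of the whole group *)

Section FullGroup.

Variables (G P : {group gT}) (L : seq (gT * nat)).
Hypotheses (cL : pchain P L) (sPD : P \subset D 0).
Hypotheses (sPG : P \subset G) (nPG : G \subset 'N(P)%g).
Hypothesis nDG : forall u, G \subset 'N(D u)%g.

Definition gjennings v : {vspace A} :=
  (\sum_(r in G) amulr (rho r) @: K L v)%VS.

Lemma mem_gjennings r v a : r \in G -> a \in K L v -> a * rho r \in gjennings v.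
Proof.
move=> Gr Ka; apply: subvP (sumv_sup r Gr (subvv _)) _ _.
by rewrite (_ : a * _ = amulr (rho r) a) ?memv_img // lfunE.
Qed.

Lemma gjennings_ind v (Q : A -> Prop) :
    Q 0 -> (forall a b, Q a -> Q b -> Q (a + b)) ->
    (forall r b, r \in G -> b \in K L v -> Q (b * rho r)) ->
  forall a, a \in gjennings v -> Q a.
Proof.
move=> Q0 QD Qg a /memv_sumP[b Kb ->]; apply: big_ind => // i Gi.
by have /memv_imgP[c Kc ->] := Kb i Gi; rewrite lfunE; apply: Qg.
Qed.

(** In a r b s the factor r is moved to the right: this replaces b by r b r^-1, of the same degree
    because G normalizes P and every [D u]. *)
Lemma gjennings_mul u v a b :
  a \in gjennings u -> b \in gjennings v -> a * b \in gjennings (u + v).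
Proof.
move=> Ia Ib; move: a Ia.
apply: (gjennings_ind (Q := fun a => a * b \in _)) => [|a a' Ia Ia'|r a Gr Ka].
- by rewrite mul0r mem0v.
- by rewrite mulrDl memvD.
move: b Ib.
apply: (gjennings_ind (Q := fun b => a * rho r * b \in _)) => [|b b' Ib Ib'|s b Gs Kb].
- by rewrite mulr0 mem0v.
- by rewrite mulrDr memvD.
have -> : a * rho r * (b * rho s) =
    a * (rho (r^-1)^-1%g * b * rho r^-1%g) * rho (r * s)%g.
  rewrite invgK rhoM !mulrA; congr (_ * _).
  by rewrite -[RHS]mulrA rhoV mulr1.
apply: mem_gjennings; first exact: groupM.
apply: (aug_filt_sub_jennings cL); apply: aug_filtM.
  exact: jennings_sub_aug_filt cL Ka.
apply: aug_filt_conj; last exact: jennings_sub_aug_filt cL Kb.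
  by rewrite groupV (subsetP nPG).
by move=> t; rewrite groupV (subsetP (nDG t)).
Qed.

Lemma gjennings_rho r : r \in G -> rho r \in gjennings 0.
Proof.
move=> Gr; rewrite -[rho r]mul1r; apply: mem_gjennings => //.
by apply: (aug_filt_sub_jennings cL); apply: aug_filt_one.
Qed.

Lemma gjennings_eq0 v : ((p.-1) * sumn (unzip2 L) < v)%N -> gjennings v = 0%VS.
Proof. by move=> ltv; rewrite /gjennings big1 // => r _; rewrite jennings_eq0 ?limg0. Qed.

(** One representative per coset of P suffices modulo [gjennings v]: for r = x r0 with x in P, the
    factor x is absorbed on the P side before splitting off low monomials. *)
Lemma dim_gjennings v :
  (\dim (gjennings 0) <= #|G : P|%g *
     count (fun t => t < v)%N (monomial_weights p (unzip2 L)) + \dim (gjennings v))%N.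
Proof.
set M := (\sum_(C in rcosets P G) amulr (rho (repr C)) @: low_monomials L v)%VS.
have leM : (\dim M <= #|G : P|%g *
     count (fun t => t < v)%N (monomial_weights p (unzip2 L)))%N.
  rewrite -sum_nat_const; apply: dimv_sum_leq => C _.
  exact: leq_trans (limg_dim_leq _ _) (dim_low_monomials _ _).
apply: leq_trans (leq_add leM (leqnn _)).
apply: leq_trans (dimvS _) (dimv_add_leqif M (gjennings v)).
apply/subvP; apply: gjennings_ind => [|a b Ia Ib|r b Gr Kb]; rewrite ?mem0v ?memvD //.
pose r0 := repr (P :* r)%g.
have [x Px def_r0] : exists2 x, x \in P & r = (x * r0)%g.
  have /rcosetP[y Py def_y] := mem_repr_rcoset P r.
  by exists y^-1%g; rewrite ?groupV // [r0]def_y mulKg.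
have Kbx : b * rho x \in K L 0.
  apply: (aug_filt_sub_jennings cL); rewrite -[0%N]addn0; apply: aug_filtM.
    exact: jennings_sub_aug_filt cL Kb.
  exact: aug_filt_rho.
have Gr0 : r0 \in G.
  by rewrite -(groupMl _ (subsetP sPG x Px)) -def_r0.
have /memv_addP[m Mm [k Kk def_bx]] := subvP (jennings_sub_low L v) _ Kbx.
rewrite def_r0 rhoM mulrA def_bx mulrDl memv_add //; last exact: mem_gjennings.
have PrG : (P :* r)%g \in rcosets P G by apply/rcosetsP; exists r.
apply: subvP (sumv_sup _ PrG (subvv _)) _ _.
by rewrite (_ : m * _ = amulr (rho r0) m) ?memv_img // lfunE.
Qed.

End FullGroup.

End JenningsFiltration.

(** * Generators adapted to the p-lower central series *)

Section PlcsChain.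

Local Open Scope group_scope.

Variables (gT : finGroupType) (p : nat) (P : {group gT}).
Hypotheses (p_pr : prime p) (pP : p.-group P).

Local Notation D := (plcs_gp p P).

(** Generators of weight j are adjoined one at a time. As [D_j, D_j] and the p-th powers of D_j lie
    in D_(j+1), each one normalizes the current group and enlarges it by index exactly p. *)
Lemma pchain_extend (N' : {group gT}) L' j : (0 < j)%N ->
    pchain D N' L' -> D j.+1 \subset N' -> N' \subset D j ->
  exists2 L, pchain D (D j) L
    & unzip2 L = nseq (logn p #|D j : N'|) j ++ unzip2 L'.
Proof.
move=> j0; move def_n: (logn p #|D j : N'|) => n.
elim: n N' L' def_n => [|n IHn] N' L' def_n cN' sDN' sN'D.
  have pDj : p.-group (D j) := pgroupS (plcs_gp_sub P p_pr j) pP.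
  have : #|D j : N'| = 1%N.
    have pi : p.-nat #|D j : N'| := pnat_dvd (dvdn_indexg _ _) pDj.
    by rewrite -(part_pnat_id pi) p_part def_n.
  move/eqP; rewrite indexg_eq1 => sDN; exists L' => //.
  have eqD : D j = N' by apply/eqP; rewrite -val_eqE eqEsubset sDN sN'D.
  by rewrite eqD.
have [g Dg N'g] : exists2 g, g \in D j & g \notin N'.
  apply/subsetPn; apply/negP; rewrite -indexg_eq1 => /eqP i1.
  by rewrite i1 logn1 in def_n.
have nN'D : D j \subset 'N(N').
  rewrite -commg_subl; apply: subset_trans (commSg _ sN'D) _.
  apply: subset_trans (plcs_gp_comm P p_pr j j) (subset_trans _ sDN').
  by apply: plcs_gp_anti => //; lia.
have nN'g : g \in 'N(N') := subsetP nN'D g Dg.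
have sgD : <[g]> \subset D j by rewrite cycle_subG.
pose N := (<[g]> <*> N')%G.
have defN : N = <[g]> * N' :> {set gT}.
  by rewrite /= norm_joinEl // cycle_subG.
have sN'N : N' \subset N := joing_subr _ _.
have sND : N \subset D j by rewrite join_subG sgD.
have iN : #|N : N'| = p.
  rewrite -card_quotient ?(subset_trans sND) // defN quotientMidr.
  rewrite quotient_cycle // -orderE; apply: nt_prime_order => //.
    rewrite -morphX //; apply: coset_id; apply: subsetP sDN' _ _.
    apply: subsetP (plcs_gp_anti _ p_pr _) _ (plcs_gp_expg p_pr Dg).
    exact: ltn_Pmull (prime_gt1 p_pr) j0.
  by apply: contra N'g => /eqP/coset_idr->.
have [||||L cL def_L] := IHn N ((g, j) :: L').
- have := def_n; rewrite -(Lagrange_index sND sN'N) iN lognM ?indexg_gt0 ?prime_gt0 //.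
  by rewrite -[X in _ + logn p X = _]expn1 pfactorK // addn1 => -[].
- apply: (@pchain_cons _ _ N') => //; last by rewrite defN.
  by rewrite mem_gen // inE cycle_id.
- exact: subset_trans sN'N.
- by [].
exists L => //; rewrite def_L /=.
by elim: (n) => //= k ->.
Qed.

Lemma pchain_plcs l : plcs p P l.+1 = 1 ->
  exists2 L, pchain D P L
    & unzip2 L = flatten [seq nseq (pdegree p P j) j | j <- iota 1 l].
Proof.
move=> D1.
(* Here k counts layers from the bottom: the chain climbs from D_(l+1) = 1 to D_1 = P. *)
suffices gen k : (k <= l)%N -> exists2 L, pchain D (D (l - k).+1) L
    & unzip2 L = flatten [seq nseq (pdegree p P j) j | j <- iota (l - k).+1 k].
  have [L cL def_L] := gen l (leqnn l); rewrite subnn in cL def_L.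
  by exists L => //; move: cL; rewrite (_ : D 1 = P) //; apply/group_inj/plcs_gp1.
elim: k => [|k IHk] le_kl.
  exists [::] => //; rewrite subn0 (_ : D _ = 1%G); first exact: pchain_nil.
  by apply: group_inj; exact: etrans (plcs_gpE P p_pr _) D1.
have [L' cL' def_L'] := IHk (ltnW le_kl).
have def_k : (l - k = (l - k.+1).+1)%N by lia.
rewrite -def_k in cL' def_L' *.
have sDD : D (l - k).+1 \subset D (l - k) by apply: plcs_gp_anti.
have [||L cL def_L] := pchain_extend _ cL' _ sDD => //; first by rewrite def_k.
exists L => //; rewrite def_L def_L' /=; congr (nseq _ _ ++ _).
have nD : D (l - k) \subset 'N(D (l - k).+1).
  exact: subset_trans (plcs_gp_sub P p_pr _) (normal_norm (plcs_gp_normal _ _ _)).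
have := card_quotient nD; rewrite !(plcs_gpE P p_pr) => card_q.
by rewrite /pdegree card_q.
Qed.

End PlcsChain.

Local Open Scope ring_scope.

(* The regular representation; [tau] reads off the coefficient of [1]. *)
Lemma regular_algebra (F : fieldType) (gT : finGroupType) :
  exists (A : falgType F) (rho : gT -> A) (tau : A -> F),
    [/\ rho 1%g = 1, {morph rho : x y / (x * y)%g >-> x * y},
        forall c a b, tau (c *: a + b) = c * tau a + tau b
      & forall x, tau (rho x) = (x == 1%g)%:R].
Proof.
pose r n (e : 'I_n -> gT) (x : gT) : 'M[F]_n :=
  \matrix_(i, j) (e i * x == e j)%g%:R.
(* The matrix algebra lives in sizes of the form n.+1, so the size is made a variable; [k] shows it
   is positive and then marks the diagonal entry read by the functional. *)
suffices reg n (e : 'I_n -> gT) (k : 'I_n) : bijective e ->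
  exists (A : falgType F) (rho : gT -> A) (tau : A -> F),
    [/\ rho 1%g = 1, {morph rho : x y / (x * y)%g >-> x * y},
        forall c a b, tau (c *: a + b) = c * tau a + tau b
      & forall x, tau (rho x) = (x == 1%g)%:R].
  by apply: reg (enum_val_bij gT); exact: enum_rank 1%g.
case: n e k => [_ []|n e k] // e_bij.
exists 'M[F]_n.+1, (r _ e), (fun M : 'M[F]_n.+1 => M k k); split.
- by apply/matrixP=> i j; rewrite !mxE mulg1 (inj_eq (bij_inj e_bij)).
- move=> x y; apply/matrixP=> i j; rewrite !mxE.
  have [f eK fK] := e_bij.
  rewrite (bigD1 (f (e i * x)%g)) //= !mxE fK eqxx mul1r mulgA big1 ?addr0 //.
  move=> l; rewrite !mxE => nel; case: eqP => [def_l|_]; last by rewrite mul0r.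
  by rewrite def_l eK eqxx in nel.
- by move=> c a b; rewrite !mxE.
by move=> x; rewrite mxE -{2}[e k]mulg1 (inj_eq (mulgI _)).
Qed.

(** * Filtration degrees of an STPP construction *)

Section FlagWeights.

Variables (F : fieldType) (V : vectType F) (X : finType) (key : X -> int).
Variables (Xs : {set X}) (alpha : X -> V) (I : nat -> {vspace V}) (B : nat).

Let after x : {vspace V} := (\sum_(y in Xs | key x < key y) <[alpha y]>)%VS.

Let wt x : nat := \max_(v < B.+1 | alpha x \in (after x + I v)%VS) v.

Let mem_wt x : alpha x \in I 0%N -> alpha x \in (after x + I (wt x))%VS.
Proof.
move=> I0x; have [|v Pv def_v] := @eq_bigmax_cond _
    [pred v : 'I_B.+1 | alpha x \in (after x + I v)%VS] (@nat_of_ord _); last first.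
  by rewrite (_ : wt x = v) // -def_v; apply: eq_bigl.
apply/card_gt0P; exists ord0; rewrite inE /=.
by apply: subvP I0x; apply: addvSr.
Qed.

Let wt_ge x v : (v <= B)%N -> alpha x \in (after x + I v)%VS -> (v <= wt x)%N.
Proof.
rewrite -ltnS => lt_vB Pv.
exact: (leq_bigmax_cond (F := fun u : 'I_B.+1 => nat_of_ord u) (Ordinal lt_vB)).
Qed.

Hypothesis key_inj : {in Xs &, injective key}.

(** Vectors of Y are added by decreasing key. One with [wt x < v] lies outside the span of the later
    ones plus [I v], so it raises the dimension by one. *)
Let count_wt v (Y : {set X}) : (v <= B)%N -> Y \subset Xs ->
  (#|[set x in Y | wt x < v]| + \dim (I v) <=
     \dim (\sum_(y in Y) <[alpha y]> + I v)%VS)%N.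
Proof.
move=> le_vB; move def_n: #|Y| => n; elim: n Y def_n => [|n IHn] Y def_n sYX.
  have -> : Y = set0 by apply/eqP; rewrite -cards_eq0 def_n.
  by rewrite big_set0 add0v; set Z := finset _; rewrite (_ : Z = set0) ?cards0 //;
    apply/setP=> x; rewrite !inE.
have [x0 Yx0] : exists x, x \in Y by apply/card_gt0P; rewrite def_n.
case: (arg_minP key Yx0) => x /= Yx min_x {x0 Yx0}; have {}Yx : x \in Y by [].
have := cardsD1 x Y; rewrite Yx def_n add1n => -[/esym def_n'].
have /IHn := subset_trans (subsetDl Y [set x]) sYX => /(_ def_n').
set Y' := Y :\ x; set U := (\sum_(y in Y') _ + _)%VS => leU.
rewrite (big_setD1 x) //= -addvA -/Y' -/U.
have sU : (U <= after x + I v)%VS.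
  apply: addvS => //; apply/subv_sumP => y; rewrite !inE => /andP[neyx Yy].
  apply: sumv_sup => //; rewrite (subsetP sYX) //=.
  rewrite lt_def min_x // andbT; apply: contra neyx => /eqP/key_inj -> //;
    exact: (subsetP sYX).
rewrite (cardsD1 x) !inE Yx /=.
have -> : [set y in Y | (wt y < v)%N] :\ x = [set y in Y' | (wt y < v)%N].
  by apply/setP=> y; rewrite !inE andbA.
have [lt_wv|_] := ltnP (wt x) v; last first.
  by rewrite add0n (leq_trans leU) // dimvS // addvSr.
have notU : alpha x \notin U.
  apply: contraL lt_wv => Ux; rewrite -leqNgt; apply: wt_ge => //.
  exact: subvP sU _ Ux.
rewrite dimv_disjoint_sum; last first.
  apply/eqP; rewrite -subv0; apply/subvP=> z; rewrite memv_cap => /andP[/vlineP[k ->]].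
  have [-> | nz_k] := eqVneq k 0; first by rewrite scale0r !mem0v.
  by rewrite rpredZeq (negPf nz_k) (negPf notU).
have nz_x : alpha x != 0 by apply: contra notU => /eqP ->; apply: mem0v.
by rewrite dim_vline nz_x; move: leU; lia.
Qed.

(** Gaussian elimination along the keys: [w x] is the largest degree, up to [B], that [alpha x]
    reaches after subtracting a combination of vectors with larger key. *)
Lemma flag_weights : (forall x, x \in Xs -> alpha x \in I 0%N) ->
    (forall v, (I v <= I 0%N)%VS) ->
  exists w : X -> nat,
    (forall v, (v <= B)%N ->
       (#|[set x in Xs | w x < v]| + \dim (I v) <= \dim (I 0))%N) /\
    (forall x, x \in Xs -> exists c : X -> F,
       [/\ c x = 1, forall y, y \in Xs -> c y != 0 -> key x <= key y
         & \sum_(y in Xs) c y *: alpha y \in I (w x)]).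
Proof.
move=> I0 sI; exists wt; split=> [v le_vB | x Xx].
  apply: leq_trans (count_wt le_vB (subxx _)) (dimvS _).
  by rewrite subv_add sI andbT; apply/subv_sumP => y Xy; rewrite -memvE I0.
have /memv_addP[_ /memv_sumP[h hP ->] [a Ia def_a]] := mem_wt (I0 x Xx).
have /fin_all_exists[k kP] y : exists k, (y \in Xs) && (key x < key y) ->
    h y = k *: alpha y.
  by case: (boolP (_ && _)) => [/hP/vlineP[k ->] | _]; [exists k | exists 0].
exists (fun y => if y == x then 1 else if key x < key y then - k y else 0).
split=> [|y Xy|]; first by rewrite eqxx.
  by have [-> //|_] := eqVneq y x; case: ltP => [/ltW //|_]; rewrite eqxx.
rewrite (bigD1 x) //= eqxx scale1r def_a addrAC.
suff -> : \sum_(y in Xs | y != x) (if y == x then 1 else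
    if key x < key y then - k y else 0) *: alpha y =
    - \sum_(y in Xs | key x < key y) h y by rewrite subrr add0r.
rewrite -sumrN big_mkcondr [RHS]big_mkcondr; apply: eq_bigr => y Xy.
case: eqP => [->|_] /=; first by rewrite ltxx.
by case: ifP => [lt_xy|_]; rewrite ?scale0r // kP ?Xy // scaleNr.
Qed.

End FlagWeights.

Section FullPairs.

Variables (gT : finGroupType) (I : finType) (S T U : I -> {set gT}).

(** In such a block every pair extends to a triple, so the bound on a sum of three degrees also
    bounds each one. The other blocks contribute nothing to the STPP sum. *)
Definition full_block i := [&& S i != set0, T i != set0 & U i != set0].

Definition block_pairs (Y Z : I -> {set gT}) : {set I * gT * gT} :=
  [set x | [&& full_block x.1.1, x.1.2 \in Y x.1.1 & x.2 \in Z x.1.1]].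

End FullPairs.

Section STPPWeights.

Variables (F : fieldType) (A : falgType F) (gT : finGroupType) (G : {group gT}).
Variables (rho : gT -> A) (tau : A -> F).
Hypothesis rhoM : {morph rho : x y / (x * y)%g >-> x * y}.
Hypothesis tau_lin : forall c a b, tau (c *: a + b) = c * tau a + tau b.
Hypothesis tau_rho : forall x, tau (rho x) = (x == 1%g)%:R.

Variables (J : nat -> {vspace A}) (W C : nat) (ms : seq nat).
Hypothesis J_rho : forall x, x \in G -> rho x \in J 0%N.
Hypothesis J_sub : forall v, (J v <= J 0%N)%VS.
Hypothesis J_mul : forall u v a b, a \in J u -> b \in J v -> a * b \in J (u + v)%N.
Hypothesis J_eq0 : forall v, (W < v)%N -> J v = 0%VS.
Hypothesis dimJ : forall v,
  (\dim (J 0%N) <= C * count (fun t => t < v)%N ms + \dim (J v))%N.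

Variables (I : finType) (S T U : I -> {set gT}).
Hypothesis stppSTU : STPP G S T U.

Local Notation pairs := (block_pairs S T U).

Lemma tau_sum (X : finType) (Q : pred X) (a : X -> A) :
  tau (\sum_(x | Q x) a x) = \sum_(x | Q x) tau (a x).
Proof.
have tau0 : tau 0 = 0 by have := tau_lin (-1) 0 0; rewrite scaler0 addr0 mulN1r addNr.
apply: big_morph => // a' b; by rewrite -[a']scale1r tau_lin mul1r scale1r.
Qed.

Lemma tauZ c a : tau (c *: a) = c * tau a.
Proof.
have := tau_sum (pred0 : pred 'I_0) (fun=> 0); rewrite !big_pred0 // => tau0.
by rewrite -[c *: a]addr0 tau_lin tau0 addr0.
Qed.

Let M := #|{: I * gT}|.
Let r (i : I) (x : gT) : nat := enum_rank (i, x).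

Let ltr i x : (r i x < M)%N. Proof. exact: ltn_ord. Qed.

Let r_inj i x i' x' : r i x = r i' x' -> i = i' /\ x = x'.
Proof. by move/val_inj/enum_rank_inj=> [-> ->]. Qed.

(** Keys are differences of two digits at different places; moving the negative terms across makes
    equality of keys an equality of expansions in base N. *)
Let euclid N a b c d : (a < N)%N -> (c < N)%N -> (a + N * d = c + N * b)%N ->
  a = c /\ d = b.
Proof.
move=> ltaN ltcN eqs; have N0 : (0 < N)%N := leq_ltn_trans (leq0n a) ltaN.
have := congr1 (modn^~ N) eqs; rewrite /= ![(N * _)%N]mulnC ![(_ + _ * N)%N]addnC.
rewrite !modnMDl !modn_small // => eq_ac; split=> //.
move/eqP: eqs; rewrite eq_ac eqn_add2l eqn_pmul2l // => /eqP; exact.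
Qed.

Let r_euclid i x i' x' y y' z z' N : (0 < N)%N ->
  (r i x + M * N * r z z' = r i' x' + M * N * r y y')%N ->
  [/\ i = i', x = x', y = z & y' = z'].
Proof.
move=> N0 /euclid[]; rewrite ?(leq_trans (ltr _ _)) ?leq_pmulr //.
by move=> /r_inj[-> ->] /r_inj[-> ->].
Qed.

(* The three keys add up to 0 on the support of the block-diagonal matrix
   multiplication tensor, so two comparable points of the support coincide. *)
Let key1 (x : I * gT * gT) : int := (r x.1.1 x.1.2)%:Z - (M * r x.1.1 x.2)%:Z.
Let key2 (x : I * gT * gT) : int :=
  (M * r x.1.1 x.1.2)%:Z - (M * M * r x.1.1 x.2)%:Z.
Let key3 (x : I * gT * gT) : int := (M * M * r x.1.1 x.1.2)%:Z - (r x.1.1 x.2)%:Z.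

Let key1_inj : injective key1.
Proof.
case=> [[i u] s] [[i' u'] s']; rewrite /key1 /= => e.
have [||-> -> _ ->] // := @r_euclid i u i' u' i s i' s' 1; rewrite ?muln1; lia.
Qed.

Let key3_inj : injective key3.
Proof.
case=> [[i u] s] [[i' u'] s']; rewrite /key3 /= => e.
have [||-> -> _ ->] // := @r_euclid i s i' s' i u i' u' M; last lia.
exact: leq_ltn_trans (ltr i u).
Qed.

Let key2_inj : injective key2.
Proof.
case=> [[i u] s] [[i' u'] s']; rewrite /key2 /= => e.
have M0 : (0 < M)%N := leq_ltn_trans (leq0n _) (ltr i u).
have [||-> -> _ ->] // := @r_euclid i u i' u' i s i' s' 1; rewrite ?muln1.
by apply/eqP; rewrite -(eqn_pmul2l M0) !mulnDr !mulnA; apply/eqP; lia.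
Qed.

Let key_sum0 i s t u : key1 (i, u, s) + key2 (i, s, t) + key3 (i, t, u) = 0.
Proof. by rewrite /key1 /key2 /key3 /=; lia. Qed.

Let sum0_eq (a b c a' b' c' : int) : a + b + c = 0 -> a' + b' + c' = 0 ->
  a' <= a -> b' <= b -> c' <= c -> [/\ a = a', b = b' & c = c'].
Proof. by move=> *; split; lia. Qed.

Let alpha (x : I * gT * gT) : A := rho (x.1.2 * x.2^-1)%g.

(** A nonzero coefficient means u' s^-1 s' t^-1 t' u^-1 = 1, a cyclic rotation of the STPP word. Its
    second condition puts the indices in one block, its first identifies the elements, and the keys
    then telescope. *)
Let alpha_prod x y z : x \in pairs U S -> y \in pairs S T -> z \in pairs T U ->
    tau (alpha x * alpha y * alpha z) != 0 ->
  key1 x + key2 y + key3 z = 0.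
Proof.
case: x y z => [[i u'] s] [[j s'] t] [[k t'] u]; rewrite !inE /=.
case/and3P=> _ Uu' Ss /and3P[_ Ss' Tt] /and3P[_ Tt' Uu].
rewrite -!rhoM tau_rho /=.
have [eq1 _ | _ /eqP//] := eqVneq (u' * s^-1 * (s' * t^-1) * (t' * u^-1))%g 1%g.
have [_ tpp1 tpp2] := stppSTU.
have {}eq1 : (s^-1 * s' * t^-1 * t' * u^-1 * u' = 1)%g.
  by apply: (mulgI u'); rewrite !mulgA in eq1 *; rewrite eq1 mul1g mulg1.
have [eq_ij eq_jk] := tpp2 _ _ _ _ _ _ _ _ _ Ss Ss' Tt Tt' Uu Uu' eq1.
subst j k; have [-> -> ->] := tpp1 _ _ _ _ _ _ _ Ss Ss' Tt Tt' Uu Uu' eq1.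
exact: key_sum0.
Qed.

(** If three degrees added up to more than W, the product of the eliminated combinations would lie
    in a zero term of the filtration. Yet its coefficient at 1 is 1: a contributing term has keys at
    least those of the given triple and summing to 0, so it is the leading one. *)
Lemma stpp_weights : exists w1 w2 w3 : I * gT * gT -> nat,
  [/\ forall i s t u, s \in S i -> t \in T i -> u \in U i ->
        (w1 (i, u, s) + w2 (i, s, t) + w3 (i, t, u) <= W)%N,
      forall v, (#|[set x in pairs U S | (w1 x < v)%N]| <=
                   C * count (fun t => t < v)%N ms)%N,
      forall v, (#|[set x in pairs S T | (w2 x < v)%N]| <=
                   C * count (fun t => t < v)%N ms)%N
    & forall v, (#|[set x in pairs T U | (w3 x < v)%N]| <=
                   C * count (fun t => t < v)%N ms)%N].
Proof.
have [sG _ _] := stppSTU.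
have J0 (Y Z : I -> {set gT}) : (forall i, Y i \subset G) -> (forall i, Z i \subset G) ->
    forall x, x \in pairs Y Z -> alpha x \in J 0%N.
  move=> sYG sZG [[i y] z]; rewrite inE /= => /and3P[_ Yy Zz].
  have [Gy Gz] := (subsetP (sYG i) _ Yy, subsetP (sZG i) _ Zz).
  by apply: J_rho; rewrite /= groupM ?groupV.
have sS i : S i \subset G by have [] := sG i.
have sT i : T i \subset G by have [] := sG i.
have sU i : U i \subset G by have [] := sG i.
(* The cap W + 1 is the first degree where [J] vanishes. *)
have [w1 [cnt1 w1P]] := flag_weights W.+1 (in2W key1_inj) (J0 _ _ sU sS) J_sub.
have [w2 [cnt2 w2P]] := flag_weights W.+1 (in2W key2_inj) (J0 _ _ sS sT) J_sub.
have [w3 [cnt3 w3P]] := flag_weights W.+1 (in2W key3_inj) (J0 _ _ sT sU) J_sub.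
have leW i s t u : s \in S i -> t \in T i -> u \in U i ->
    (w1 (i, u, s) + w2 (i, s, t) + w3 (i, t, u) <= W)%N.
  move=> Ss Tt Uu; rewrite leqNgt; apply/negP => ltW.
  have fi : full_block S T U i by apply/and3P; split; apply/set0Pn; [exists s|exists t|exists u].
  have X1 : (i, u, s) \in pairs U S by rewrite inE /= fi Uu.
  have X2 : (i, s, t) \in pairs S T by rewrite inE /= fi Ss.
  have X3 : (i, t, u) \in pairs T U by rewrite inE /= fi Tt.
  have [c1 [c1x c1P J1]] := w1P _ X1.
  have [c2 [c2x c2P J2]] := w2P _ X2.
  have [c3 [c3x c3P J3]] := w3P _ X3.
  have := J_mul (J_mul J1 J2) J3; rewrite J_eq0 // memv0 => /eqP prod0.
  pose term y1 y2 y3 := c1 y1 * c2 y2 * c3 y3 * tau (alpha y1 * alpha y2 * alpha y3).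
  have term0 y1 y2 y3 : y1 \in pairs U S -> y2 \in pairs S T -> y3 \in pairs T U ->
      term y1 y2 y3 != 0 -> [/\ y1 = (i, u, s), y2 = (i, s, t) & y3 = (i, t, u)].
    move=> Xy1 Xy2 Xy3; rewrite !mulf_eq0 !negb_or -!andbA => /and4P[nz1 nz2 nz3 nzt].
    have k1 := c1P _ Xy1 nz1; have k2 := c2P _ Xy2 nz2; have k3 := c3P _ Xy3 nz3.
    have key0 := alpha_prod Xy1 Xy2 Xy3 nzt.
    have [e1 e2 e3] := sum0_eq key0 (key_sum0 i s t u) k1 k2 k3.
    by split; [apply: key1_inj | apply: key2_inj | apply: key3_inj].
  have := congr1 tau prod0; rewrite -[X in tau X = _ -> _]/(_ * _ * _).
  have -> : tau 0 = 0 by rewrite -[0](scale0r 0) tauZ mul0r.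
  have -> : tau ((\sum_(y in pairs U S) c1 y *: alpha y) *
      (\sum_(y in pairs S T) c2 y *: alpha y) *
      (\sum_(y in pairs T U) c3 y *: alpha y)) =
    \sum_(y1 in pairs U S) \sum_(y2 in pairs S T) \sum_(y3 in pairs T U) term y1 y2 y3.
    rewrite !mulr_suml tau_sum; apply: eq_bigr => y1 _.
    rewrite [X in X * _]mulr_sumr mulr_suml tau_sum; apply: eq_bigr => y2 _.
    rewrite mulr_sumr tau_sum; apply: eq_bigr => y3 _.
    rewrite -scalerAr -!scalerAl -scalerAr -!scalerAl !scalerA tauZ /term; ring.
  rewrite (bigD1 (i, u, s)) //= [X in _ + X]big1 ?addr0 => [|y1 /andP[Xy1 ne1]]; last first.
    rewrite big1 // => y2 Xy2; rewrite big1 // => y3 Xy3.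
    by apply/eqP; apply: contraNT ne1 => /term0[//|//|//|-> _ _].
  rewrite (bigD1 (i, s, t)) //= [X in _ + X]big1 ?addr0 => [|y2 /andP[Xy2 ne2]]; last first.
    rewrite big1 // => y3 Xy3.
    by apply/eqP; apply: contraNT ne2 => /term0[//|//|//|_ -> _].
  rewrite (bigD1 (i, t, u)) //= [X in _ + X]big1 ?addr0 => [|y3 /andP[Xy3 ne3]]; last first.
    by apply/eqP; apply: contraNT ne3 => /term0[//|//|//|_ _ ->].
  rewrite /term c1x c2x c3x !mul1r -!rhoM tau_rho /= !mulgA mulgKV mulgKV mulgV eqxx.
  by apply/eqP/oner_neq0.
(* Beyond W + 1 the left-hand count is constant, since all degrees are at most W, and [J v] stays
   0. *)
have cntP (Y Z : I -> {set gT}) (w : I * gT * gT -> nat) :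
    (forall v, (v <= W.+1)%N ->
      (#|[set x in pairs Y Z | (w x < v)%N]| + \dim (J v) <= \dim (J 0%N))%N) ->
    (forall x, x \in pairs Y Z -> (w x <= W)%N) ->
  forall v, (#|[set x in pairs Y Z | (w x < v)%N]| <= C * count (fun t => t < v)%N ms)%N.
  move=> cnt lew v; rewrite -(leq_add2r (\dim (J v))); apply: leq_trans (dimJ v).
  have [le_v|lt_v] := leqP v W.+1; first exact: cnt.
  apply: leq_trans (cnt _ (leqnn _)); rewrite !J_eq0 ?(ltnW lt_v) // leq_add2r.
  apply: subset_leq_card; apply/subsetP=> x; rewrite !inE => /andP[Xx _].
  by rewrite Xx ltnS lew // inE.
exists w1, w2, w3; split=> //; apply: cntP => // -[[i y] z];
  rewrite inE /= => /and3P[/and3P[/set0Pn[s Ss] /set0Pn[t Tt] /set0Pn[u Uu]] Yy Zz].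
- by rewrite (leq_trans _ (leW i z t y Zz Tt Yy)) // -addnA leq_addr.
- by rewrite (leq_trans _ (leW i y z u Yy Zz Uu)) // addnAC leq_addl.
- by rewrite (leq_trans _ (leW i s y z Ss Yy Zz)) // leq_addl.
Qed.

End STPPWeights.

(** * Real estimates *)

Section Analysis.

Variable R : realType.

(** A telescoping sum over thresholds v >= n. For 0 <= lam <= 1 its coefficients are nonnegative, so
    bounds on counts below every threshold pass to sums of powers of lam. *)
Lemma layer_cake (lam : R) (B n : nat) : (n <= B)%N ->
  lam ^+ n = \sum_(v < B) (n <= v)%:R * (lam ^+ v - lam ^+ v.+1) + lam ^+ B.
Proof.
elim: B n => [|B IHB] n; first by rewrite leqn0 => /eqP->; rewrite big_ord0 add0r.
rewrite leq_eqVlt => /predU1P[->|]; last first.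
  rewrite ltnS => le_nB; rewrite {1}(IHB _ le_nB) big_ord_recr /= le_nB mul1r.
  by rewrite -addrA subrK.
rewrite big1 ?add0r // => v _.
by rewrite leqNgt (leq_trans (ltn_ord v)) ?mul0r.
Qed.

Lemma sum_expr_le_of_count (lam : R) (X : finType) (Xs : {set X}) (w : X -> nat)
    (C : nat) (ms : seq nat) : 0 <= lam <= 1 ->
    (forall v, #|[set x in Xs | w x < v]| <= C * count (fun t => t < v) ms)%N ->
  \sum_(x in Xs) lam ^+ w x <= C%:R * \sum_(t <- ms) lam ^+ t.
Proof.
move=> /andP[lam0 lam1] cnt.
pose B := (\max_(x in Xs) w x + \max_(t <- ms) t)%N.
have leXB x : x \in Xs -> (w x <= B)%N.
  by move=> Xx; apply: leq_trans (leq_addr _ _); apply: leq_bigmax_cond.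
have leMB t : t \in ms -> (t <= B)%N.
  by move=> Mt; apply: leq_trans (leq_addl _ _); apply: leq_bigmax_seq.
have XsE (f : nat -> bool) : \sum_(x in Xs) (f (w x))%:R = #|[set x in Xs | f (w x)]|%:R :> R.
  rewrite -sum1_card natr_sum [RHS](eq_bigl (fun x => (x \in Xs) && f (w x))).
    by rewrite [RHS]big_mkcondr; apply: eq_bigr => x _; case: f.
  by move=> x; rewrite inE.
have msE (f : nat -> bool) : \sum_(t <- ms) (f t)%:R = (count f ms)%:R :> R.
  by rewrite -sum1_count natr_sum [RHS]big_mkcond; apply: eq_bigr => x _; case: f.
under eq_bigr => x Xx do rewrite (layer_cake lam (leXB x Xx)).
rewrite (eq_big_seq _ (fun t Mt => layer_cake lam (leMB t Mt))).
rewrite !big_split /= mulrDr; apply: lerD; last first.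
  rewrite sumr_const -[_ *+ #|Xs|]mulr_natl.
  have -> : \sum_(t <- ms) lam ^+ B = (size ms)%:R * lam ^+ B.
    by rewrite big_const_seq count_predT iter_addr_0 mulr_natl.
  rewrite mulrA ler_wpM2r ?exprn_ge0 // -natrM ler_nat.
  apply: leq_trans (leq_trans (cnt B.+1) _); last by rewrite leq_mul2l count_size orbT.
  by apply: subset_leq_card; apply/subsetP=> x Xx; rewrite inE Xx ltnS leXB.
rewrite exchange_big [X in _ <= _ * X]exchange_big mulr_sumr; apply: ler_sum => v _.
rewrite -!mulr_suml mulrA ler_wpM2r //; last first.
  by rewrite (XsE (fun n => n <= v)%N) (msE (fun n => n <= v)%N) -natrM ler_nat; apply: (cnt v.+1).
by rewrite subr_ge0 exprS ler_piMl ?exprn_ge0.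
Qed.

Lemma sum_monomial_weights (lam : R) p ws :
  \sum_(t <- monomial_weights p ws) lam ^+ t =
  \prod_(w <- ws) \sum_(i < p) lam ^+ (i * w).
Proof.
elim: ws => [|w ws IHws]; first by rewrite big_nil big_seq1 expr0.
rewrite big_cons -IHws /= big_allpairs_dep /= mulr_suml.
rewrite -{1}[p]subn0 -/(index_iota 0 p) big_mkord; apply: eq_bigr => i _.
by rewrite mulr_sumr; apply: eq_bigr => t _; rewrite exprD.
Qed.

Lemma AGM3 (x y z : R) : 0 <= x -> 0 <= y -> 0 <= z ->
  3 * (x * y * z) <= x ^+ 3 + y ^+ 3 + z ^+ 3.
Proof.
move=> x0 y0 z0; rewrite -subr_ge0.
have -> : x ^+ 3 + y ^+ 3 + z ^+ 3 - 3 * (x * y * z) =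
  2^-1 * ((x + y + z) * ((x - y) ^+ 2 + (y - z) ^+ 2 + (z - x) ^+ 2)) by field.
apply: mulr_ge0; first by rewrite invr_ge0.
apply: mulr_ge0; first lra.
by rewrite addr_ge0 ?sqr_ge0 // addr_ge0 ?sqr_ge0.
Qed.

Lemma cbrt_expr3 (x : R) : 0 <= x -> (x `^ 3^-1) ^+ 3 = x.
Proof. by move=> x0; rewrite -powR_mulrn ?powR_ge0 // -powRrM mulVf ?powRr1 ?pnatr_eq0. Qed.

(** Each double sum is averaged over the third set, which turns its terms into cubes of mu^w over
    the cube root of that set's size. AM-GM is then applied at every (a, b, c), where the degrees
    add up to at most W. Taking lam = mu^3 avoids fractional powers of lam. *)
Lemma block_weights_ineq (T : finType) (A B C : {set T}) (w1 w2 w3 : T -> T -> nat)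
    (W : nat) (mu : R) : 0 <= mu <= 1 ->
    (forall a b c, a \in A -> b \in B -> c \in C ->
       (w1 c a + w2 a b + w3 b c <= W)%N) ->
  3 * mu ^+ W * (#|A| * #|B| * #|C|)%N%:R `^ (2 / 3) <=
    \sum_(c in C) \sum_(a in A) (mu ^+ 3) ^+ w1 c a +
    \sum_(a in A) \sum_(b in B) (mu ^+ 3) ^+ w2 a b +
    \sum_(b in B) \sum_(c in C) (mu ^+ 3) ^+ w3 b c.
Proof.
move=> /andP[mu0 mu1] leW; have [n0|] := posnP (#|A| * #|B| * #|C|)%N.
  rewrite n0 powR0 ?mulr0 ?mulf_neq0 ?invr_neq0 ?pnatr_eq0 //.
  by rewrite !addr_ge0 // !sumr_ge0 // => *; rewrite sumr_ge0 // => *; rewrite !exprn_ge0.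
rewrite !muln_gt0 -andbA => /and3P[A0 B0 C0].
pose root n : R := n%:R `^ 3^-1.
have root3 n : root n ^+ 3 = n%:R by rewrite cbrt_expr3.
have root_gt0 n : (0 < n)%N -> 0 < root n by move=> n0; rewrite powR_gt0 ?ltr0n.
set al := root #|A|; set be := root #|B|; set ga := root #|C|.
have [al0 be0 ga0] : [/\ 0 < al, 0 < be & 0 < ga] by split; apply: root_gt0.
have -> : (#|A| * #|B| * #|C|)%N%:R `^ (2 / 3) = (al * be * ga) ^+ 2 :> R.
  by rewrite mulrC powRrM powR_mulrn ?powR_ge0 // !natrM !powRM ?mulr_ge0.
have spread (X Y Z : {set T}) (w : T -> T -> nat) : (0 < #|Z|)%N ->
    \sum_(x in X) \sum_(y in Y) (mu ^+ 3) ^+ w x y =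
    \sum_(x in X) \sum_(y in Y) \sum_(z in Z) (mu ^+ w x y / root #|Z|) ^+ 3.
  move=> Z0; apply: eq_bigr => x _; apply: eq_bigr => y _.
  rewrite sumr_const -mulr_natl expr_div_n root3 mulrCA divff ?mulr1 -?exprM 1?mulnC //.
  by rewrite pnatr_eq0 -lt0n.
rewrite (spread _ _ B) // (spread _ _ C) // (spread _ _ A) // -/al -/be -/ga.
have -> : \sum_(c in C) \sum_(a in A) \sum_(b in B) (mu ^+ w1 c a / be) ^+ 3 =
    \sum_(a in A) \sum_(b in B) \sum_(c in C) (mu ^+ w1 c a / be) ^+ 3.
  by rewrite exchange_big; apply: eq_bigr => a _; rewrite exchange_big.
have -> : \sum_(b in B) \sum_(c in C) \sum_(a in A) (mu ^+ w3 b c / al) ^+ 3 =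
    \sum_(a in A) \sum_(b in B) \sum_(c in C) (mu ^+ w3 b c / al) ^+ 3.
  by under eq_bigr do rewrite exchange_big; rewrite exchange_big.
rewrite -!big_split /=.
have -> : 3 * mu ^+ W * (al * be * ga) ^+ 2 =
    \sum_(a in A) \sum_(b in B) \sum_(c in C) (3 * mu ^+ W / (al * be * ga)).
  rewrite !sumr_const -[_ *+ #|A|]mulr_natr -[_ *+ #|B|]mulr_natr -[_ *+ #|C|]mulr_natr.
  rewrite -[#|A|%:R]root3 -[#|B|%:R]root3 -[#|C|%:R]root3 -/al -/be -/ga.
  have alg (m a b c : R) : a != 0 -> b != 0 -> c != 0 ->
      3 * m * (a * b * c) ^+ 2 = 3 * m / (a * b * c) * c ^+ 3 * b ^+ 3 * a ^+ 3.
    by move=> ? ? ?; field; apply/and3P; split.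
  by apply: alg; rewrite lt0r_neq0.
apply: ler_sum => a Aa; rewrite -!big_split /=.
apply: ler_sum => b Bb.
rewrite -!big_split /=; apply: ler_sum => c Cc.
have nng n (x : R) : 0 < x -> 0 <= mu ^+ n / x.
  by move=> x0; rewrite divr_ge0 ?exprn_ge0 // ltW.
apply: le_trans (AGM3 (nng _ _ be0) (nng _ _ ga0) (nng _ _ al0)).
have -> : mu ^+ w1 c a / be * (mu ^+ w2 a b / ga) * (mu ^+ w3 b c / al) =
    mu ^+ (w1 c a + w2 a b + w3 b c) / (al * be * ga).
  by rewrite !exprD -!mulrA !invfM; ring.
rewrite [leRHS]mulrA ler_wpM2r ?invr_ge0 ?[_ <= al * _ * _]ltW ?mulr_gt0 //.
rewrite ler_wpM2l //.
by apply: ler_wiXn2l; rewrite ?mu0 ?mu1 ?leW.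
Qed.

(** From exp(-y) <= 1 / (1 + y) and (1 + y)(1 - y + y^2) = 1 + y^3. *)
Lemma expRN_le (y : R) : 0 <= y -> expR (- y) <= 1 - y + y ^+ 2.
Proof.
move=> y0; have y1 : 0 < 1 + y by lra.
have : expR (- y) <= (1 + y)^-1.
  by rewrite expRN lef_pV2 ?posrE ?expR_gt0 // expR_ge1Dx.
move/le_trans; apply; rewrite -[leLHS]mul1r ler_pdivrMr //; nra.
Qed.

(** Each term is expanded to second order; the mean of i over 0, ..., p - 1 is (p - 1)/2, and 1 + x
    <= exp x restores an exponential. *)
Lemma sum_expR_le (p w : nat) (s : R) : 0 <= s ->
  \sum_(i < p) expR (- s) ^+ (i * w) <=
    p%:R * expR (- (s * p.-1%:R * w%:R / 2) + (s * p.-1%:R * w%:R) ^+ 2).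
Proof.
move=> s0; set z := s * p.-1%:R * w%:R.
have le_i (i : 'I_p) : expR (- s) ^+ (i * w) <=
    1 - s * w%:R * i%:R + z ^+ 2.
  rewrite -expRM_natl mulrN natrM.
  apply: le_trans (expRN_le _) _; first by rewrite !mulr_ge0.
  have le_ip : i%:R <= p.-1%:R :> R.
    by rewrite ler_nat -ltnS prednK // (leq_ltn_trans _ (ltn_ord i)).
  have : (i%:R * w%:R * s) ^+ 2 <= z ^+ 2.
    rewrite ler_sqr ?nnegrE ?mulr_ge0 // /z mulrC mulrA ler_wpM2r // ler_wpM2l //.
  lra.
apply: le_trans (ler_sum _ (fun i _ => le_i i)) _.
rewrite big_split sumr_const card_ord sumrB sumr_const card_ord -mulr_sumr /=.
have sum_i : \sum_(i < p) i%:R = p%:R * p.-1%:R / 2 :> R.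
  elim: (p) => [|[|n] IHn]; first by rewrite big_ord0 !mul0r.
    by rewrite big_ord1 mulr0 mul0r.
  by rewrite big_ord_recr /= IHn /= -[n.+2%:R]natr1 -[n.+1%:R]natr1; field.
rewrite sum_i -[z ^+ 2 *+ p]mulr_natl.
have -> : p%:R - s * w%:R * (p%:R * p.-1%:R / 2) + p%:R * z ^+ 2 =
  p%:R * (1 + (- (z / 2) + z ^+ 2)) by rewrite /z; field.
by rewrite ler_wpM2l // expR_ge1Dx.
Qed.

Lemma prod_sum_expR_le (p : nat) (ws : seq nat) (s : R) : 0 <= s ->
  \prod_(w <- ws) \sum_(i < p) expR (- s) ^+ (i * w) <=
    (p ^ size ws)%N%:R * expR (- (s * p.-1%:R * (\sum_(w <- ws) w%:R) / 2)
       + (s * p.-1%:R) ^+ 2 * \sum_(w <- ws) w%:R ^+ 2).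
Proof.
move=> s0; elim: ws => [|w ws IHws].
  by rewrite !big_nil !mulr0 mul0r oppr0 add0r expR0 mulr1.
rewrite !big_cons /= expnS natrM.
have -> : - (s * p.-1%:R * (w%:R + \sum_(w <- ws) w%:R) / 2) +
    (s * p.-1%:R) ^+ 2 * (w%:R ^+ 2 + \sum_(w <- ws) w%:R ^+ 2) =
  (- (s * p.-1%:R * w%:R / 2) + (s * p.-1%:R * w%:R) ^+ 2) +
  (- (s * p.-1%:R * (\sum_(w <- ws) w%:R) / 2)
       + (s * p.-1%:R) ^+ 2 * \sum_(w <- ws) w%:R ^+ 2) :> R by field.
rewrite expRD mulrACA ler_pM ?sum_expR_le // ?sumr_ge0 // => [i _|].
  by rewrite exprn_ge0 ?expR_ge0.
by rewrite prodr_ge0 // => w' _; rewrite sumr_ge0 // => i _; rewrite exprn_ge0 ?expR_ge0.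
Qed.

End Analysis.

(** * Bounds for one group *)

(** The weights of the generators from [pchain_plcs]. A uniformly random entry has the law of X_r,
    so sums over this list are n times expectations. *)
Definition plcs_weights (gT : finGroupType) p (P : {group gT}) l : seq nat :=
  flatten [seq nseq (pdegree p P j) j | j <- iota 1 l].

Lemma sum_plcs_weights (R : realType) (gT : finGroupType) p (P : {group gT}) l
    (f : nat -> R) :
  \sum_(w <- plcs_weights p P l) f w =
  \sum_(i < l) (nth 0%N (pdegrees p P l) i)%:R * f i.+1.
Proof.
rewrite big_flatten /= big_map (iotaDl 1 0 l) big_map.
rewrite -{1}[l]subn0 -/(index_iota 0 l) big_mkord; apply: eq_bigr => i _.
rewrite big_nseq iter_addr_0 mulr_natl (nth_map 0%N) ?size_iota //.
by rewrite nth_iota.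
Qed.

Lemma size_plcs_weights (gT : finGroupType) p (P : {group gT}) l :
  prime p -> (p.-group P)%g -> plcs p P l.+1 = 1%g ->
  size (plcs_weights p P l) = logn p #|P|.
Proof.
move=> p_pr pP D1.
suffices logE k : logn p #|P : plcs_gp p P k.+1|%g =
    sumn [seq pdegree p P j | j <- iota 1 k].
  rewrite size_flatten /shape -map_comp (eq_map (fun j => size_nseq _ _)) -logE.
  by rewrite (plcs_gpE P p_pr) D1 indexg1.
elim: k => [|k IHk]; first by rewrite (plcs_gp1 P p_pr) indexgg logn1.
rewrite -[X in iota _ X]addn1 iotaD map_cat sumn_cat -IHk [sumn (map _ _)]/= addn0 add1n.
have sDD : plcs_gp p P k.+2 \subset plcs_gp p P k.+1 by apply: plcs_gp_anti.
rewrite -(Lagrange_index (plcs_gp_sub P p_pr k.+1) sDD) lognM ?indexg_gt0 //.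
congr (_ + _)%N.
have nD : plcs_gp p P k.+1 \subset 'N(plcs_gp p P k.+2)%g.
  exact: subset_trans (plcs_gp_sub P p_pr _) (normal_norm (plcs_gp_normal _ _ _)).
have := card_quotient nD; rewrite !(plcs_gpE P p_pr) => card_q.
by rewrite /pdegree card_q.
Qed.

Lemma sum_block_pairs (R : realType) (gT : finGroupType) (I : finType)
    (S T U Y Z : I -> {set gT}) (f : I * gT * gT -> R) :
  \sum_(x in block_pairs S T U Y Z) f x =
  \sum_(i | full_block S T U i) \sum_(y in Y i) \sum_(z in Z i) f (i, y, z).
Proof.
rewrite pair_big_dep pair_big_dep /=; apply: eq_big => [x|[[i y] z] _] //.
by rewrite inE -andbA.
Qed.

(** Here lam = exp(-s). With S1 the sum of the weights, the product over the weights gains s (p - 1)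
    S1 / 2 in the exponent and dividing by lam^(W/3) costs s (p - 1) S1 / 3, which leaves the factor
    1/6. *)
Lemma stpp_sum_le (R : realType) (p : nat) (gT : finGroupType) (G P : {group gT})
    (l : nat) (I : finType) (S T U : I -> {set gT}) (s : R) :
    prime p -> (p.-group P)%g -> (P <| G)%g -> plcs p P l.+1 = 1%g ->
    STPP G S T U -> 0 <= s ->
  \sum_i (#|S i| * #|T i| * #|U i|)%N%:R `^ (2 / 3) <=
    #|G|%:R * expR (- (s * p.-1%:R * (\sum_(w <- plcs_weights p P l) w%:R) / 6)
                    + (s * p.-1%:R) ^+ 2 * \sum_(w <- plcs_weights p P l) w%:R ^+ 2).
Proof.
move=> p_pr pP /andP[sPG nPG] D1 stpp s0.
set ws := plcs_weights p P l.
have [L cL def_ws] := pchain_plcs p_pr pP D1.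
rewrite -/(plcs_weights p P l) -/ws in def_ws.
have [A [rho [tau [rho1 rhoM tau_lin tau_rho]]]] := regular_algebra 'F_p gT.
have chFp := pchar_Fp p_pr.
have D_anti i j : (i <= j)%N -> plcs_gp p P j \subset plcs_gp p P i.
  exact: plcs_gp_anti.
have D_comm i j := plcs_gp_comm P p_pr i j.
have D_expg i x : x \in plcs_gp p P i -> (x ^+ p)%g \in plcs_gp p P (p * i).
  exact: plcs_gp_expg.
have nDG u : G \subset 'N(plcs_gp p P u)%g.
  by apply/subsetP=> x Gx; apply: plcs_gp_norm => //; apply: (subsetP nPG).
have sPD : P \subset plcs_gp p P 0 by rewrite plcs_gp0.
have J_sub v : (gjennings p rho G L v <= gjennings p rho G L 0)%VS.
  apply/subv_sumP => r Gr; apply: (sumv_sup r) => //.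
  by apply: limgS; apply: jennings_anti.
have [w1 [w2 [w3 [leW cnt1 cnt2 cnt3]]]] := stpp_weights rhoM tau_lin tau_rho
  (gjennings_rho chFp rho1 rhoM D_anti D_comm D_expg cL) J_sub
  (gjennings_mul chFp rho1 rhoM D_anti D_comm D_expg cL nPG nDG)
  (fun v => @gjennings_eq0 p _ _ _ rho chFp G L v)
  (dim_gjennings chFp rho1 rhoM D_anti D_comm D_expg cL sPD sPG) stpp.
rewrite def_ws in leW cnt1 cnt2 cnt3.
pose mu := expR (- (s / 3)).
have mu01 : 0 <= mu <= 1.
  by rewrite expR_ge0 expR_le1 oppr_le0 divr_ge0.
have lamE : mu ^+ 3 = expR (- s).
  by rewrite -expRM_natl; congr expR; field.
have lam01 : 0 <= mu ^+ 3 <= 1 by rewrite lamE expR_ge0 expR_le1 oppr_le0.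
set W := (p.-1 * sumn ws)%N in leW.
set C := #|G : P|%g in cnt1 cnt2 cnt3.
set ms := monomial_weights p ws in cnt1 cnt2 cnt3.
set Z := \sum_(t <- ms) (mu ^+ 3) ^+ t.
have main : mu ^+ W * \sum_i (#|S i| * #|T i| * #|U i|)%N%:R `^ (2 / 3) <= C%:R * Z.
  rewrite -(ler_pM2l (_ : 0 < 3)) // mulrA mulr_sumr.
  have -> : 3 * (C%:R * Z) = C%:R * Z + C%:R * Z + C%:R * Z by ring.
  apply: le_trans (lerD (lerD (sum_expr_le_of_count lam01 cnt1)
    (sum_expr_le_of_count lam01 cnt2)) (sum_expr_le_of_count lam01 cnt3)).
  rewrite !sum_block_pairs -!big_split /=.
  rewrite (bigID (full_block S T U)) /= [X in _ + X]big1 ?addr0 => [|i].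
    apply: ler_sum => i _.
    apply: (@block_weights_ineq R gT (S i) (T i) (U i) (fun u s => w1 (i, u, s))
      (fun s t => w2 (i, s, t)) (fun t u => w3 (i, t, u)) W mu mu01).
    by move=> x y z; apply: leW.
  (* A block with an empty set contributes 0, as 0 to the power 2/3 is 0. *)
  rewrite !negb_and !negbK => n0.
  have -> : (#|S i| * #|T i| * #|U i|)%N = 0%N.
    by case/or3P: n0 => /eqP->; rewrite cards0 ?muln0 ?mul0n.
  by rewrite powR0 ?mulr0 // mulf_neq0 ?invr_neq0 ?pnatr_eq0.
have leZ := prod_sum_expR_le p ws s0.
rewrite -sum_monomial_weights -lamE -/ms -/Z in leZ.
have muW : mu ^+ W = expR (- (s * p.-1%:R * (\sum_(w <- ws) w%:R) / 3)).
  rewrite -expRM_natl /W natrM sumnE natr_sum; by congr expR; field.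
rewrite -(ler_pM2l (_ : 0 < mu ^+ W)); last by rewrite muW expR_gt0.
apply: le_trans main _.
apply: le_trans (ler_wpM2l _ leZ) _; first exact: ler0n.
rewrite mulrA -natrM size_plcs_weights //.
have -> : (C * p ^ logn p #|P|)%N = #|G|.
  by rewrite -p_part part_pnat_id // mulnC Lagrange.
rewrite mulrCA muW -expRD ler_wpM2l // ler_expR.
by rewrite le_eqVlt; apply/orP; left; apply/eqP; field.
Qed.

(** The minimum over x of - S1 x / 6 + S2 x^2 is - S1^2 / (144 S2), whence the constant 144. *)
Lemma stpp_sum_le_card (R : realType) (kappa : R) (p : nat) (gT : finGroupType)
    (G P : {group gT}) (l : nat) (I : finType) (S T U : I -> {set gT}) :
    prime p -> (p.-group P)%g -> (P <| G)%g -> plcs p P l.+1 = 1%g ->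
    STPP G S T U -> 0 < kappa ->
    (logn p #|P|)%:R * (\sum_(w <- plcs_weights p P l) w%:R ^+ 2) <=
      kappa * (\sum_(w <- plcs_weights p P l) w%:R) ^+ 2 ->
  \sum_i (#|S i| * #|T i| * #|U i|)%N%:R `^ (2 / 3) <=
    #|G|%:R * expR (- ((logn p #|P|)%:R / (144 * kappa))).
Proof.
move=> p_pr pP nPG D1 stpp k0; set ws := plcs_weights p P l.
set S1 := \sum_(w <- ws) w%:R; set S2 := \sum_(w <- ws) w%:R ^+ 2 => leS.
set n := (logn p #|P|)%:R in leS *.
have S1_ge0 : 0 <= S1 by apply: sumr_ge0.
have p1 : 0 < p.-1%:R :> R by rewrite ltr0n -ltnS prednK ?prime_gt1 ?prime_gt0.
have nS2 : n <= S2.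
  rewrite /n -(size_plcs_weights p_pr pP D1) -/ws -sum1_size natr_sum /S2.
  rewrite big_seq [leRHS]big_seq; apply: ler_sum => w.
  case/flattenP=> s /mapP[j]; rewrite mem_iota => /andP[j_gt0 _] ->.
  by case/nseqP=> -> _; rewrite -natrX ler1n expn_gt0 j_gt0.
have n_ge0 : 0 <= n by apply: ler0n.
(* If S2 = 0, then n = 0, all weights being at least 1, and s = 0 already gives the bound. *)
have [S20|S2_neq0] := eqVneq S2 0.
  have -> : n = 0 by apply/eqP; rewrite eq_le n_ge0 andbT -S20.
  have := stpp_sum_le p_pr pP nPG D1 stpp (lexx (0 : R)).
  by rewrite !mul0r expr0n /= !mul0r oppr0 addr0.
have S2_gt0 : 0 < S2 by rewrite lt_def S2_neq0 (le_trans n_ge0).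
(* This value of [s] minimizes the quadratic exponent in [stpp_sum_le]. *)
have s_ge0 : 0 <= S1 / (12 * p.-1%:R * S2) by rewrite divr_ge0 // !mulr_ge0 // ltW.
apply: le_trans (stpp_sum_le p_pr pP nPG D1 stpp s_ge0) _.
rewrite -/ws -/S1 -/S2 ler_wpM2l // ler_expR.
have -> : - (S1 / (12 * p.-1%:R * S2) * p.-1%:R * S1 / 6) +
    (S1 / (12 * p.-1%:R * S2) * p.-1%:R) ^+ 2 * S2 = - (S1 ^+ 2 / (144 * S2)).
  by field; rewrite !lt0r_neq0.
rewrite lerN2 ler_pdivrMr; last by rewrite mulr_gt0.
rewrite mulrAC ler_pdivlMr ?mulr_gt0 //; lra.
Qed.

(** * From moments of X_r to power sums of the weights *)

Section Degrees.

Variables (R : realType) (gT : finGroupType) (p : nat) (P : {group gT}) (l : nat).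
Hypotheses (p_pr : prime p) (pP : (p.-group P)%g) (D1 : plcs p P l.+1 = 1%g).

Let ws := plcs_weights p P l.
Let n : R := (logn p #|P|)%:R.
Let S1 : R := \sum_(w <- ws) w%:R.
Let S2 : R := \sum_(w <- ws) w%:R ^+ 2.

Let sumn_pdegrees : (sumn (pdegrees p P l))%:R = n.
Proof.
rewrite /n -(size_plcs_weights p_pr pP D1) -sum1_size natr_sum sum_plcs_weights.
rewrite sumnE (big_nth 0%N) size_map size_iota big_mkord natr_sum.
by apply: eq_bigr => i _; rewrite mulr1.
Qed.

Let sum_expect (f : nat -> R) :
  expect_X (pdegrees p P l) f = (\sum_(w <- ws) f w) / n.
Proof.
rewrite /expect_X sum_plcs_weights mulr_suml size_map size_iota.
by apply: eq_bigr => i _; rewrite sumn_pdegrees mulrAC.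
Qed.

Let EX_E : EX R (pdegrees p P l) = S1 / n.
Proof. exact: sum_expect. Qed.

Let weights_bound w : w \in ws -> (0 < w <= l)%N.
Proof.
case/flattenP=> s /mapP[j]; rewrite mem_iota => /andP[j_gt0 ltj] ->.
by case/nseqP=> -> _; rewrite j_gt0 -ltnS.
Qed.

Let size_ws : (size ws)%:R = n.
Proof. by rewrite size_plcs_weights. Qed.

(** The variance is S2 / n - (S1 / n)^2, so n S2 <= S1^2 + M n^2, and n <= S1 because weights are at
    least 1. *)
Lemma weights_of_variance (M : R) : 0 < n -> 0 <= M ->
  VarX R (pdegrees p P l) <= M -> n * S2 <= (1 + M) * S1 ^+ 2.
Proof.
move=> n0 M0; rewrite /VarX sum_expect EX_E ler_pdivrMr //.
have -> : \sum_(w <- ws) (w%:R - S1 / n) ^+ 2 = S2 - S1 ^+ 2 / n.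
  under eq_bigr do rewrite sqrrB.
  rewrite !big_split /= sumrN sumrMnl -mulr_suml -/S1 -/S2 big_const_seq.
  rewrite count_predT iter_addr_0 -[_ *+ size ws]mulr_natr size_ws.
  by field; rewrite lt0r_neq0.
have S1n : n <= S1.
  rewrite -size_ws -sum1_size natr_sum /S1 big_seq [leRHS]big_seq.
  by apply: ler_sum => w /weights_bound/andP[w0 _]; rewrite ler_nat.
move=> leV; have : n * (S2 - S1 ^+ 2 / n) <= n * (M * n) by rewrite ler_pM2l.
rewrite mulrBr (_ : n * (S1 ^+ 2 / n) = S1 ^+ 2); last by field; rewrite lt0r_neq0.
have : M * n ^+ 2 <= M * S1 ^+ 2 by rewrite ler_wpM2l // ler_sqr ?nnegrE // ltW // (lt_le_trans n0).
lra.
Qed.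

(** Weights are at most l, so S2 <= n l^2, while the hypothesis says n l <= c S1. *)
Lemma weights_of_expectation (c : R) : 0 < n -> 0 < c ->
  l%:R / c <= EX R (pdegrees p P l) -> n * S2 <= c ^+ 2 * S1 ^+ 2.
Proof.
move=> n0 c0; rewrite EX_E ler_pdivrMr // mulrAC ler_pdivlMr // => lel.
have leS2 : S2 <= n * l%:R ^+ 2.
  rewrite -size_ws -sum1_size natr_sum mulr_suml /S2 big_seq [leRHS]big_seq.
  apply: ler_sum => w /weights_bound/andP[_ lewl].
  by rewrite mul1r ler_sqr ?nnegrE // ler_nat.
have : (n * l%:R) ^+ 2 <= (c * S1) ^+ 2.
  rewrite ler_sqr ?nnegrE ?mulr_ge0 ?(ltW n0) ?(ltW c0) ?sumr_ge0 //; lra.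
have : n * S2 <= n * (n * l%:R ^+ 2) by rewrite ler_pM2l.
rewrite !exprMn; lra.
Qed.

End Degrees.

(** * Families of groups *)

(** By Cauchy every prime divisor is at most the exponent, so |G| is a product of at most m prime
    powers, each bounded by the largest one. *)
Lemma large_sylow (gT : finGroupType) (G : {group gT}) (m : nat) :
    (1 < #|G|)%N -> (exponent G <= m)%N ->
  exists p, [/\ prime p, (p %| #|G|)%N, (p <= m)%N
              & (#|G| <= (p ^ logn p #|G|) ^ m)%N].
Proof.
move=> G1 expG.
have le_pm q : q \in primes #|G| -> (0 < q < m.+1)%N.
  rewrite mem_primes => /and3P[q_pr _ /(Cauchy q_pr)[x Gx <-]].
  by rewrite order_gt0 ltnS (leq_trans _ expG) // dvdn_leq ?exponent_gt0 ?dvdn_exponent.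
pose P (q : 'I_m.+1) := (q : nat) \in primes #|G|.
have pG : pdiv #|G| \in primes #|G|.
  by rewrite mem_primes pdiv_prime // pdiv_dvd cardG_gt0.
have lt_p0 : (pdiv #|G| < m.+1)%N by have /andP[] := le_pm _ pG.
have Pp0 : P (Ordinal lt_p0) by [].
case: (arg_maxnP (fun q : 'I_m.+1 => q ^ logn q #|G|)%N Pp0) => p Pp max_p.
have := Pp; rewrite /P mem_primes => /and3P[p_pr _ p_dvd].
exists p; split=> //; first by rewrite -ltnS.
rewrite {1}(prod_prime_decomp (cardG_gt0 G)) prime_decompE big_map /=.
have le_size : (size (primes #|G|) <= m)%N.
  rewrite -(size_iota 1 m); apply: uniq_leq_size (primes_uniq _) _ => q /le_pm.
  by rewrite mem_iota add1n.
apply: leq_trans (_ : _ <= (p ^ logn p #|G|) ^ size (primes #|G|))%N _; last first.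
  by rewrite leq_pexp2l // expn_gt0 prime_gt0.
have : {subset primes #|G| <= primes #|G|} by [].
elim: {-2}(primes #|G|) => [|q s IHs] sub_s; first by rewrite big_nil.
rewrite big_cons expnS leq_mul //; last first.
  by apply: IHs => r s_r; apply: sub_s; rewrite inE s_r orbT.
have Gq : q \in primes #|G| by apply: sub_s; rewrite mem_head.
have lt_qm : (q < m.+1)%N by have /andP[] := le_pm _ Gq.
exact: max_p (Ordinal lt_qm) Gq.
Qed.

Lemma sum_irr_dim_sqr (gT : finGroupType) (G : {group gT}) :
  (\sum_(j : Iirr G) irr_dim j ^ 2)%N = #|G|.
Proof.
apply/eqP; rewrite -(eqr_nat algC) -irr_sum_square natr_sum; apply/eqP.
by apply: eq_bigr => j _; rewrite natrX irr1_degree.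
Qed.

(** This crude bound pays for raising the exponent: n_i^(delta/3) <= |G|^delta. *)
Lemma stpp_block_le (gT : finGroupType) (G : {group gT}) (I : finType)
    (S T U : I -> {set gT}) i : STPP G S T U ->
  (#|S i| * #|T i| * #|U i| <= #|G| ^ 3)%N.
Proof.
case=> /(_ i)[sS sT sU] _ _; rewrite !expnS expn0 muln1 -mulnA.
by rewrite !leq_mul ?subset_leq_card.
Qed.

Theorem theorem3p19 (R : realType) (F : group_family)
  (Fnil : forall (gT : finGroupType) (G : {group gT}), F gT G -> nilpotent G)
  (Fexp : bounded_exponent F)
  (Fdeg : bounded_variance R F \/ linear_expectation R F) :
  exists tau : R, (2 < tau <= 3)%R /\
    forall (gT : finGroupType) (G : {group gT}), F gT G ->
    forall (I : finType) (S T U : I -> {set gT}), STPP G S T U ->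
      (\sum_(i : I) (#|S i| * #|T i| * #|U i|)%N%:R `^ (tau / 3)
         <= \sum_(j : Iirr G) (irr_dim j)%:R `^ tau :> R)%R.
Proof.
have [m expF] := Fexp.
(* Both alternatives on the degrees enter only through this inequality between power sums. *)
have [kappa k0 degF] : exists2 kappa : R, 0 < kappa &
    forall (gT : finGroupType) (G : {group gT}), F gT G ->
    forall (p : nat) (P : {group gT}) (l : nat),
      prime p -> (p %| #|G|)%N -> (p.-Sylow(G) P)%g -> plcs_length p P l ->
      (logn p #|P|)%:R * (\sum_(w <- plcs_weights p P l) w%:R ^+ 2) <=
        kappa * (\sum_(w <- plcs_weights p P l) w%:R) ^+ 2.
  have logP0 (gT : finGroupType) (G P : {group gT}) p : prime p ->
      (p %| #|G|)%N -> (p.-Sylow(G) P)%g -> 0 < (logn p #|P|)%:R :> R.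
    move=> p_pr pG sylP; rewrite ltr0n (card_Hall sylP) p_part pfactorK //.
    by rewrite -pfactor_dvdn ?expn1.
  case: Fdeg => [[M VarM]|[c c0 EXc]].
    (* The given M could be negative if the family imposes no condition. *)
    exists (1 + Num.max M 0) => [|gT G FG p P l p_pr pG sylP lP].
      by rewrite ltr_pwDl // le_max lexx orbT.
    apply: weights_of_variance => //.
    - exact: pHall_pgroup sylP.
    - by case: lP.
    - exact: logP0 sylP.
    - by rewrite le_max lexx orbT.
    - by rewrite le_max (VarM _ _ FG _ _ _ p_pr pG sylP lP).
  exists (c ^+ 2) => [|gT G FG p P l p_pr pG sylP lP]; first exact: exprn_gt0.
  apply: weights_of_expectation => //.
  - exact: pHall_pgroup sylP.
  - by case: lP.
  - exact: logP0 sylP.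
  - exact: EXc FG _ _ _ p_pr pG sylP lP.
(* From |G| <= p^(n m), p <= m and p <= exp p follows |G| <= exp(p n m); eps is chosen so that
   |G|^eps <= exp(n / (144 kappa)). Using m + 1 keeps the denominator positive. *)
pose eps : R := (144 * kappa * m.+1%:R ^+ 2)^-1.
have eps0 : 0 < eps by rewrite invr_gt0 !mulr_gt0 ?exprn_gt0.
pose delta := Num.min 1 eps.
have delta0 : 0 < delta by rewrite lt_min ltr01.
exists (2 + delta); split.
  have : delta <= 1 by rewrite ge_min lexx.
  by lra.
move=> gT G FG I S T U stpp.
apply: (@le_trans _ _ #|G|%:R); last first.
  rewrite -[in leLHS](sum_irr_dim_sqr G) natr_sum; apply: ler_sum => j _.
  rewrite natrX -powR_mulrn // ler_powR ?ler1n ?irr_degree_gt0 //.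
  by rewrite lerDl ltW.
have block_le i : (#|S i| * #|T i| * #|U i|)%N%:R `^ ((2 + delta) / 3) <=
    #|G|%:R `^ delta * (#|S i| * #|T i| * #|U i|)%N%:R `^ (2 / 3) :> R.
  have [->|n_gt0] := posnP (#|S i| * #|T i| * #|U i|)%N.
    rewrite powR0 ?mulr_ge0 ?powR_ge0 // gt_eqF // divr_gt0 //; lra.
  rewrite mulrDl powRD; last by rewrite pnatr_eq0 -lt0n n_gt0 implybT.
  rewrite mulrC ler_wpM2r ?powR_ge0 //.
  have -> : #|G|%:R `^ delta = (#|G| ^ 3)%N%:R `^ (delta / 3) :> R.
    by rewrite natrX -powR_mulrn // -powRrM; congr (_ `^ _); field.
  apply: ge0_ler_powR; rewrite ?nnegrE //; first by rewrite divr_ge0 // ltW.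
  by rewrite ler_nat (stpp_block_le i stpp).
apply: le_trans (ler_sum _ (fun i _ => block_le i)) _; rewrite -mulr_sumr.
(* Stated without p dividing |G|, so that the trivial group is covered too. *)
suffices [p [p_pr [leG degp]]] : exists p, prime p /\
    (#|G|%:R `^ delta <= expR ((logn p #|G|)%:R / (144 * kappa)) /\
     forall l, plcs_length p 'O_p(G)%G l ->
       (logn p #|'O_p(G)%G|)%:R *
         (\sum_(w <- plcs_weights p 'O_p(G)%G l) w%:R ^+ 2) <=
       kappa * (\sum_(w <- plcs_weights p 'O_p(G)%G l) w%:R) ^+ 2).
  have sylP := nilpotent_pcore_Hall p (Fnil _ _ FG).
  have [l lP] := plcs_length_exists p_pr (pcore_pgroup p G).
  have le_sum := stpp_sum_le_card p_pr (pcore_pgroup p G) (pcore_normal p G)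
    (proj1 lP) stpp k0 (degp l lP).
  have logP : logn p #|'O_p(G)%G| = logn p #|G|.
    by rewrite (card_Hall sylP) p_part pfactorK.
  rewrite logP in le_sum.
  have sum_ge0 : 0 <= \sum_i (#|S i| * #|T i| * #|U i|)%N%:R `^ (2 / 3) :> R.
    by apply: sumr_ge0 => i _; apply: powR_ge0.
  apply: le_trans (ler_pM (powR_ge0 _ _) sum_ge0 leG le_sum) _.
  by rewrite mulrCA -expRD subrr expR0 mulr1.
have [G_gt1|] := ltnP 1 #|G|.
  have [p [p_pr p_dvd le_pm leG]] := large_sylow G_gt1 (expF _ _ FG).
  exists p; split=> //; split; last first.
    move=> l lP; apply: (degF _ _ FG) p_pr p_dvd _ lP.
    exact: nilpotent_pcore_Hall (Fnil _ _ FG).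
  set n := logn p #|G| in leG *.
  have leGexp : #|G|%:R <= expR (p%:R * n%:R * m%:R) :> R.
    apply: (@le_trans _ _ (((p ^ n) ^ m)%N%:R)); first by rewrite ler_nat.
    rewrite expRM_natr expRM_natr !natrX.
    have le_p : p%:R <= expR p%:R :> R.
      by apply: le_trans (expR_ge1Dx _); rewrite lerDr.
    apply: lerXn2r; rewrite ?nnegrE ?exprn_ge0 ?expR_ge0 //.
    by apply: lerXn2r; rewrite ?nnegrE ?expR_ge0.
  apply: (@le_trans _ _ (expR (p%:R * n%:R * m%:R) `^ delta)).
    by apply: ge0_ler_powR; rewrite ?nnegrE ?expR_ge0 ?(ltW delta0).
  rewrite -expRM ler_expR.
  have le_pm1 : p%:R <= m.+1%:R :> R by rewrite ler_nat leqW.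
  have le_mm1 : m%:R <= m.+1%:R :> R by rewrite ler_nat.
  have le_deps : delta <= eps by rewrite ge_min lexx orbT.
  have -> : n%:R / (144 * kappa) = m.+1%:R * n%:R * m.+1%:R * eps.
    have alg (x y z : R) : x != 0 -> y != 0 ->
        z / (144 * y) = x * z * x * (144 * y * x ^+ 2)^-1.
      by move=> ? ?; field; apply/andP.
    by apply: alg; rewrite ?pnatr_eq0 // lt0r_neq0.
  by rewrite !ler_pM ?mulr_ge0 ?(ltW delta0).
move=> leG1; have cG1 : #|G| = 1%N by apply/eqP; rewrite eqn_leq leG1 cardG_gt0.
(* For the trivial group any prime would do, since n = 0. *)
exists 2%N; split=> //; split.
  by rewrite cG1 powR1 logn1 mul0r expR0.
move=> l lP.
have -> : logn 2 #|'O_2%N(G)%G| = 0%N.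
  have := subset_leq_card (pcore_sub 2%N G); rewrite cG1.
  by case: #|_| (cardG_gt0 'O_2%N(G)%G) => [|[|]].
by rewrite mul0r mulr_ge0 ?sqr_ge0 ?ltW.
Qed.
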